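(* Let $G$ be a planar graph. Then $s(G) \leq 7$, where $s(G)$ is the surrounding cop number of $G$.
   Context: Surrounding Cops and Robbers is a perfect-information game played on a finite graph $G$ by two players. The first player controls a team of cops $C_1,\dots,C_m$; the second controls one robber. Initially, the first player places each cop on some vertex of $G$, and then the second player places the robber on some vertex of $G$. Then the two players alternate in taking turns. On the first player's turn, she moves each cop to an adjacent vertex or leaves it at its current vertex. On the second player's turn, he moves the robber to an adjacent vertex or leaves the robber at its current vertex. Two cops may occupy the same vertex, and a cop and the robber may occupy the same vertex, but the second player may not end a turn with the robber on the same vertex as a cop. The first player wins if at any point the robber occupies a vertex $r$ such that each neighbor of $r$ is occupied by a cop (the robber is surrounded). The second player wins by indefinitely preventing the first player from winning. The surrounding cop number $s(G)$ of a finite graph $G$ is the minimum $m$ such that the first player, with a team of $m$ cops, has a winning strategy on $G$.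
   Formalization: The planar graph G is additionally assumed to be connected; without this the claim fails, for example for eight disjoint copies of K2, where seven cops leave a component in which the robber is never surrounded. *)

(* Defs.v *)
From mathcomp Require Import all_boot all_order all_algebra.
From mathcomp Require Import all_classical all_reals topology normedtype.

Set Implicit Arguments.
Unset Strict Implicit.
Unset Printing Implicit Defensive.

Import Order.TTheory GRing.Theory Num.Theory.
Import numFieldNormedType.Exports.

Record sgraph := SGraph {
  svertex :> finType;
  sedge : rel svertex;
  sedge_sym : symmetric sedge;
  sedge_irr : irreflexive sedge }.

Arguments sedge {s}.

(* Needed for any bound on the surrounding cop number of planar graphs: on    *)
(* m + 1 disjoint copies of K2, m cops leave some component unvisited.       *)
Definition connected_graph (G : sgraph) : Prop :=
  forall x y : G, connect sedge x y.

Section Planarity.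
Local Open Scope ring_scope.
Local Open Scope classical_set_scope.

(* The arc of an edge uv is given in both directions, [arc v u] being        *)
(* [arc u v] traversed backwards, so that each edge is drawn as one curve.   *)
Record plane_drawing (R : realType) (G : sgraph)
    (pt : G -> R * R) (arc : G -> G -> R -> R * R) : Prop := PlaneDrawing {
  pt_inj : injective pt;
  arc_continuous : forall u v, sedge u v ->
    {within `[0, 1], continuous (arc u v)};
  arc_inj : forall u v, sedge u v -> {in `[0, 1] &, injective (arc u v)};
  arc_source : forall u v, sedge u v -> arc u v 0 = pt u;
  arc_target : forall u v, sedge u v -> arc u v 1 = pt v;
  arc_reverse : forall u v, sedge u v ->
    {in `[0, 1], forall t, arc v u t = arc u v (1 - t)};
  arc_avoids_vertices : forall u v w, sedge u v ->
    {in `]0, 1[, forall t, arc u v t <> pt w};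
  arcs_do_not_cross : forall u v u' v', sedge u v -> sedge u' v' ->
    {in `]0, 1[ &, forall s t, arc u v s = arc u' v' t ->
      (u', v') = (u, v) \/ (u', v') = (v, u)} }.

Definition planar (R : realType) (G : sgraph) : Prop :=
  exists pt arc, @plane_drawing R G pt arc.

End Planarity.

Section SurroundingCopsAndRobbers.
Variables (G : sgraph) (m : nat).

Definition placement := {ffun 'I_m -> G}.

Definition step (x y : G) : bool := (x == y) || sedge x y.

Definition occupied (c : placement) (v : G) : bool := [exists i, c i == v].

Definition surrounded (c : placement) (r : G) : bool :=
  [forall v, sedge r v ==> occupied c v].

(* A strategy of the cops maps the list of all robber positions seen so far, *)
(* oldest first, to the next placement of the cops; its value at [::] is     *)
(* the initial placement.                                                    *)
Definition cop_strategy := seq G -> placement.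

Definition legal_strategy (S : cop_strategy) : Prop :=
  forall (h : seq G) (x : G) (i : 'I_m), step (S h i) (S (rcons h x) i).

(* If the robber is placed at [r 0] and moves to [r 1], [r 2], ..., then     *)
(* [cops_at S r n] is the placement after the n-th turn of the cops. The     *)
(* robber's n-th turn, from [r n.-1] to [r n], takes place after it.         *)
Definition cops_at (S : cop_strategy) (r : nat -> G) (n : nat) : placement :=
  S (mkseq r n).

(* The robber may start on the vertex of a cop: the prohibition only         *)
(* concerns the end of a turn. He has a legal move unless surrounded, so no  *)
(* play is lost by considering infinite ones only.                           *)
Definition legal_robber (S : cop_strategy) (r : nat -> G) : Prop :=
  forall n, step (r n) (r n.+1) /\ ~~ occupied (cops_at S r n.+1) (r n.+1).

(* The robber can get surrounded after his own n-th turn (or his placement,  *)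
(* for n = 0), or after the next turn of the cops.                           *)
Definition winning_strategy (S : cop_strategy) : Prop :=
  forall r, legal_robber S r ->
  exists n, surrounded (cops_at S r n) (r n)
         || surrounded (cops_at S r n.+1) (r n).

Definition cops_win : Prop :=
  exists S, legal_strategy S /\ winning_strategy S.

End SurroundingCopsAndRobbers.

Lemma cops_win_card (G : sgraph) : cops_win G #|G|.
Proof.
exists (fun _ => [ffun i => enum_val i]); split.
  by move=> h x i; rewrite !ffunE /step eqxx.
move=> r _; exists 0; apply/orP; left; apply/forallP => v; apply/implyP => _.
by apply/existsP; exists (enum_rank v); rewrite ffunE enum_rankK.
Qed.

Lemma ex_cops_win (G : sgraph) : exists m, `[< cops_win G m >].
Proof. by exists #|G|; apply/asboolP; exact: cops_win_card. Qed.

Definition surrounding_cop_number (G : sgraph) : nat :=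
  ex_minn (ex_cops_win G).

(* Main.v *)
Require Import Defs.
From mathcomp Require Import all_classical all_reals topology normedtype.
From mathcomp Require Import all_boot all_order all_algebra zify lra.
Set Implicit Arguments.
Unset Strict Implicit.
Unset Printing Implicit Defensive.
Import Order.TTheory GRing.Theory Num.Theory.
Import numFieldNormedType.Exports.

(* While the robber r is confined to a connected territory R, a path P that   *)
(* is geodesic for walks through R is closed to him by three cops on P (p-1), *)
(* P p, P (p+1) as soon as |p - i| <= d_R(r, P i) for all i, and such p can   *)
(* be maintained by Helly's theorem. If P is tight, i.e. walks through R      *)
(* between two vertices of P are strictly longer than P between them, then    *)
(* two cops suffice.                                                          *)
(*   The territory is kept enclosed by a cycle one of whose arcs is guarded   *)
(* by two cops. If the other arc is tight too, three cops are free to occupy  *)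
(* a shortest path through R between two vertices of the cycle; if it is not, *)
(* it is replaced along a detour W through R that spans a shortest possible   *)
(* window b < i < t. Inside that window P is tight, so one of its three       *)
(* cops joins the two idle ones on W, and if the robber forces p out of the   *)
(* window meanwhile, then P and W agree at P p and W is guarded at once.      *)
(*   Either way a component of R minus a new path is left, and by planarity   *)
(* it is not attached to all three sides of a theta graph: with a point of    *)
(* that component they would form a subdivision of K33.                       *)
(*   For K33, round a plane drawing to a fine lattice so that independent     *)
(* edges stay apart. Let a, b, c be the walks from one branch vertex to the   *)
(* three opposite ones. Counting modulo 2 the crossings of these walks with   *)
(* their translates by (1/2, 1/2), winding numbers show that the sum over     *)
(* ordered pairs is even, whereas the local picture at the branch vertex      *)
(* makes it odd.                                                              *)

(** * Parity of crossings of lattice walks *)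

(** The strategy is an induction on the size of the territory R, the component to which the robber
    is confined, over three kinds of position, each using all seven cops ([wins_all]). In
    [wins_vertex] one cop on a single vertex encloses R and six are idle. In [wins_loose] R is
    enclosed by a cycle; three cops hold a geodesic arc, two guard the rest and two are idle. In
    [wins_tight] both arcs are held by two cops each and three are idle. From a tight position the
    three idle cops take a shortest path through R between two vertices of the cycle ([take_path]),
    which gives a loose position on a smaller R; if at most one vertex of the cycle is attached to
    R, the position is a vertex position instead. A loose position becomes tight if its geodesic is
    tight; otherwise [detour_wins] cuts R along a shortest detour. A vertex position shrinks R by
    occupying a further vertex. Planarity enters through [theta_free], in [chord_split]: once a path
    is taken, only one of the two old arcs still borders the robber's component, so the guards of
    the other one become idle. It rests on [no_lattice_K33] and [planar_lattice_drawing]. The game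
    is played on the well-founded trees [robber_loses], which [cops_win_of_robber_loses] converts
    into a strategy. *)

Definition point : Type := int * int.
Definition segment : Type := point * point.

Definition near (d : nat) (u v : point) : bool :=
  (`|u.1 - v.1| <= d) && (`|u.2 - v.2| <= d).

Definition lstep (u v : point) : bool :=
  near 1 u v && ((u.1 == v.1) || (u.2 == v.2)).

Definition horizontal (e : segment) : bool :=
  (e.1.2 == e.2.2) && (e.1.1 != e.2.1).
Definition vertical (e : segment) : bool :=
  (e.1.1 == e.2.1) && (e.1.2 != e.2.2).

Definition leftmost (e : segment) : int := Order.min e.1.1 e.2.1.
Definition rightmost (e : segment) : int := Order.max e.1.1 e.2.1.
Definition lowest (e : segment) : int := Order.min e.1.2 e.2.2.
Definition highest (e : segment) : int := Order.max e.1.2 e.2.2.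

(* The segment e meets the translate of f by (1/2, 1/2), transversally.       *)
Definition crosses (e f : segment) : bool :=
  [&& horizontal e, vertical f, leftmost e == leftmost f & highest e == highest f]
  || [&& vertical e, horizontal f, rightmost e == rightmost f & lowest e == lowest f].

(* The segment e meets the ray going right from z + (1/2, 1/2).               *)
Definition right_of (e : segment) (z : point) : bool :=
  [&& vertical e, lowest e == z.2 & (z.1 < leftmost e)%R].

(* The ray attached to a point of f runs over u as that point moves along f.  *)
Definition swept (u : point) (f : segment) : bool :=
  [&& vertical f, u.2 == highest f & (f.1.1 < u.1)%R].

(** The direction (1, 1) of the translation splits the four lattice directions into two sides of a
    diagonal; this is one of them. *)
Definition up_or_left (u v : point) : bool := (u.2 < v.2)%R || (v.1 < u.1)%R.

Lemma lstepP (u v : point) : lstep u v ->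
  v = u \/ v = (u.1 + 1, u.2)%R \/ v = (u.1 - 1, u.2)%R \/
  v = (u.1, u.2 + 1)%R \/ v = (u.1, u.2 - 1)%R.
Proof.
case: u v => a b [c d]; rewrite /lstep /near /= => H.
have : (c = a /\ d = b) \/ (c = (a + 1)%R /\ d = b) \/ (c = (a - 1)%R /\ d = b) \/
  (c = a /\ d = (b + 1)%R) \/ (c = a /\ d = (b - 1)%R) by lia.
by case=> [[-> ->]|[[-> ->]|[[-> ->]|[[-> ->]|[-> ->]]]]]; tauto.
Qed.

Lemma unit_step_simpl (a : int) :
  ((a == a + 1 = false)%R * (a + 1 == a = false)%R * (a == a - 1 = false)%R * (a - 1 == a = false)%R
  * (a < a + 1 = true)%R * (a + 1 < a = false)%R * (a < a - 1 = false)%R * (a - 1 < a = true)%R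
  * (Order.min a (a + 1) = a)%R * (Order.max a (a + 1) = a + 1)%R
  * (Order.min a (a - 1) = a - 1)%R * (Order.max a (a - 1) = a)%R
  * (Order.min (a + 1) a = a)%R * (Order.max (a + 1) a = a + 1)%R
  * (Order.min (a - 1) a = a - 1)%R * (Order.max (a - 1) a = a)%R
  * (Order.min a a = a)%R * (Order.max a a = a)%R)%type.
Proof. by repeat split; lia. Qed.

Ltac lattice_cases :=
  move=> /lstepP + /lstepP;
  case=> [->|[->|[->|[->|->]]]]; case=> [->|[->|[->|[->|->]]]];
  rewrite /crosses /right_of /swept /up_or_left /horizontal /vertical /leftmost /rightmost /lowest
    /highest ?xpair_eqE /= ?unit_step_simpl ?eqxx ?ltxx /= ?andbF ?andbT ?addbF /=.

(** As z moves, its ray gains or loses the segment either because z passes through it or because the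
    ray sweeps over one of its ends. *)
Lemma ray_move (u u' z z' : point) : lstep u u' -> lstep z z' ->
  right_of (u, u') z (+) right_of (u, u') z' =
  crosses (u, u') (z, z') (+) (swept u (z, z') (+) swept u' (z, z')).
Proof.
case: u z => [a b] [c d]; lattice_cases.
all: by [] || lia.
Qed.

Definition same_side (e f : segment) : bool :=
  (e.1 == f.1) && (up_or_left e.1 e.2 == up_or_left f.1 f.2).

(** Slide the translate of the second segment along the diagonal from (1/2, 1/2) to (-1/2, -1/2).
    The crossing parity can change only when the segments share an end, and a shared end contributes
    a change when they leave it on the same side of the diagonal. *)
Lemma crosses_sym (u u' z z' : point) : lstep u u' -> lstep z z' ->
  crosses (u, u') (z, z') (+) crosses (z, z') (u, u') =
  (same_side (u, u') (z, z') (+) same_side (u, u') (z', z)) (+)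
  (same_side (u', u) (z, z') (+) same_side (u', u) (z', z)).
Proof.
case: u z => [a b] [c d]; rewrite /same_side; lattice_cases.
all: by [] || lia.
Qed.
Lemma crosses_near (u u' z z' : point) : lstep u u' -> lstep z z' ->
  crosses (u, u') (z, z') -> near 1 u z.
Proof.
case: u z => [a b] [c d]; rewrite /near; lattice_cases.
all: by [] || lia.
Qed.

Definition trail (u : point) (s : seq point) : seq segment := pairmap pair u s.
Definition steps (E : seq segment) : bool := all (fun e => lstep e.1 e.2) E.

Lemma trail_cat u s t : trail u (s ++ t) = trail u s ++ trail (last u s) t.
Proof. exact: pairmap_cat. Qed.

Lemma steps_trail u s : path lstep u s -> steps (trail u s).
Proof. by elim: s u => //= v s IH u /andP[-> /IH]. Qed.

Lemma mem_trail u s e : e \in trail u s -> e.1 \in u :: s /\ e.2 \in u :: s.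
Proof.
elim: s u => //= v s IH u; rewrite inE => /predU1P[->|/IH[h1 h2]] /=.
  by rewrite !inE !eqxx orbT.
by split; rewrite in_cons ?h1 ?h2 orbT.
Qed.

Lemma telescope_trail (h : point -> bool) u s :
  \big[addb/false]_(e <- trail u s) (h e.1 (+) h e.2) = h u (+) h (last u s).
Proof.
elim: s u => [|v s IH] u /=; first by rewrite big_nil addbb.
by rewrite big_cons IH /= -addbA addKb.
Qed.

Definition crossing (E F : seq segment) : bool :=
  \big[addb/false]_(e <- E) \big[addb/false]_(f <- F) crosses e f.
Definition winding (E : seq segment) (z : point) : bool :=
  \big[addb/false]_(e <- E) right_of e z.

Lemma crossing_catl E E' F : crossing (E ++ E') F = crossing E F (+) crossing E' F.
Proof. exact: big_cat. Qed.

Lemma crossing_far (E F : seq segment) : steps E -> steps F ->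
  (forall e f, e \in E -> f \in F -> ~~ near 1 e.1 f.1) -> crossing E F = false.
Proof.
move=> /allP sE /allP sF far; rewrite /crossing big_seq big1 // => e eE.
rewrite big_seq big1 // => f fF; apply: negbTE.
apply: contraNN (far e f eE fF) => {far}.
move: (sE _ eE) (sF _ fF) => {eE fF}; case: e f => [u u'] [z z'] /=; exact: crosses_near.
Qed.

Lemma winding_move u s z t : path lstep u s -> path lstep z t ->
  winding (trail u s) z (+) winding (trail u s) (last z t) =
  crossing (trail u s) (trail z t) (+)
  \big[addb/false]_(f <- trail z t) (swept u f (+) swept (last u s) f).
Proof.
move=> /steps_trail/allP su /steps_trail/allP sz.
rewrite -(telescope_trail (winding (trail u s))) /crossing exchange_big /= -big_split /=.
rewrite big_seq [RHS]big_seq; apply: eq_bigr => f fF.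
rewrite -(telescope_trail (swept^~ f)) -!big_split /=.
rewrite big_seq [RHS]big_seq; apply: eq_bigr => e eE.
by case: e f fF eE => [a b] [c d] /sz h1 /su h2; rewrite ray_move.
Qed.

(** The two walks form a closed curve: the sweeping terms at their common ends cancel. *)
Lemma winding_move2 u s s' z t : path lstep u s -> path lstep u s' ->
  last u s = last u s' -> path lstep z t ->
  winding (trail u s) z (+) winding (trail u s) (last z t) (+)
  (winding (trail u s') z (+) winding (trail u s') (last z t)) =
  crossing (trail u s) (trail z t) (+) crossing (trail u s') (trail z t).
Proof.
move=> hs hs' e ht; rewrite !winding_move // e.
by rewrite addbACA addbb addbF.
Qed.

Definition corner (E : seq segment) (v : point) : bool :=
  \big[addb/false]_(e <- E)
    (((v == e.1) && up_or_left e.1 e.2) (+) ((v == e.2) && up_or_left e.2 e.1)).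

Lemma corner0 u s v : v \notin u :: s -> corner (trail u s) v = false.
Proof.
move=> v_s; rewrite /corner big_seq big1 // => e /mem_trail[h1 h2].
have [/eqP|_] := boolP (v == e.1); first by move=> e1; rewrite e1 h1 in v_s.
by have [/eqP|//] := boolP (v == e.2); move=> e2; rewrite e2 h2 in v_s.
Qed.

(** Segment ends at v on the other side of the diagonal are all ends at v minus those in [corner];
    the parity of all ends at v depends only on whether the walk starts or stops there. *)
Lemma same_side_sum u s v (k : bool) :
  \big[addb/false]_(f <- trail u s)
    (((v == f.1) && (k == up_or_left f.1 f.2)) (+) ((v == f.2) && (k == up_or_left f.2 f.1))) =
  ~~ k && ((v == u) (+) (v == last u s)) (+) corner (trail u s) v.
Proof.
rewrite -(telescope_trail (eq_op v)) (big_morph (andb (~~ k)) (andb_addr _) (andbF _)).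
rewrite -big_split /=; apply: eq_bigr => f _.
by case: (v == _) (v == _) k (up_or_left _ _) (up_or_left _ _) => -[] [] [] [].
Qed.

(* Crossing is not symmetric because of the translation; the defect is local  *)
(* to the common origin of the two walks.                                     *)
Lemma crossing_swap x s t : path lstep x s -> path lstep x t ->
  last x s \notin x :: t -> last x t \notin x :: s ->
  crossing (trail x s) (trail x t) (+) crossing (trail x t) (trail x s) =
  ~~ (corner (trail x s) x (+) corner (trail x t) x).
Proof.
move=> hs ht a_t b_s; set b := last x t in b_s *.
have := steps_trail hs; have := steps_trail ht => /allP st /allP ss.
rewrite /crossing [X in _ (+) X]exchange_big -big_split /=.
transitivity (\big[addb/false]_(e <- trail x s)
  ((~~ up_or_left e.1 e.2 && (e.1 == x) (+) ~~ up_or_left e.2 e.1 && (e.2 == x)) (+)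
   (corner (trail x t) e.1 (+) corner (trail x t) e.2))).
  rewrite big_seq [RHS]big_seq; apply: eq_bigr => e es.
  have [/negbTE n1 /negbTE n2] : e.1 != b /\ e.2 != b.
    by have [h1 h2] := mem_trail es; split; [move: h1|move: h2]; apply: contraTneq => ->.
  transitivity ((~~ up_or_left e.1 e.2 && ((e.1 == x) (+) (e.1 == b)) (+) corner (trail x t) e.1)
    (+) (~~ up_or_left e.2 e.1 && ((e.2 == x) (+) (e.2 == b)) (+) corner (trail x t) e.2)); last first.
    by rewrite n1 n2 !addbF addbACA.
  rewrite -!same_side_sum -!big_split /= big_seq [RHS]big_seq; apply: eq_bigr => f ft.
  by case: e f es ft {n1 n2} => [u u'] [z z'] /ss h1 /st h2; rewrite crosses_sym.
rewrite big_split /= telescope_trail (corner0 a_t) addbF.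
rewrite -[RHS]addNb; congr (_ (+) _).
have deg : \big[addb/false]_(e <- trail x s) ((x == e.1) (+) (x == e.2)) = true.
  rewrite telescope_trail eqxx; have [e|//] := eqVneq x (last x s).
  by rewrite -e mem_head in a_t.
rewrite -[RHS]addTb -[X in _ = X (+) _]deg /corner -big_split /=; apply: eq_bigr => e _.
by rewrite ![_ == x]eq_sym; case: (x == _) (x == _) (up_or_left _ _) (up_or_left _ _) => -[] [] [].
Qed.

Definition far (s t : seq point) : Prop := forall p q, p \in s -> q \in t -> ~~ near 1 p q.

Lemma far_crossing u s z t : path lstep u s -> path lstep z t -> far (u :: s) (z :: t) ->
  crossing (trail u s) (trail z t) = false.
Proof.
move=> /steps_trail hs /steps_trail ht h; apply: crossing_far => // e f /mem_trail[h1 _].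
by case/mem_trail => h2 _; apply: h.
Qed.

Lemma near_trans d e p q r : near d p q -> near e q r -> near (d + e) p r.
Proof. by rewrite /near; lia. Qed.

Lemma nearxx d p : near d p p.
Proof. by rewrite /near; lia. Qed.

Lemma near_sym d p q : near d p q = near d q p.
Proof. by rewrite /near; lia. Qed.

(* Only independent edges of K33 are kept apart: adjacent ones may overlap.   *)
Lemma no_lattice_K33 (x y w : point) (a : 'I_3 -> point) (s t r : 'I_3 -> seq point) :
  (forall i, path lstep x (s i) /\ last x (s i) = a i) ->
  (forall i, path lstep (a i) (t i) /\ last (a i) (t i) = y) ->
  (forall i, path lstep (a i) (r i) /\ last (a i) (r i) = w) ->
  (forall i j, i != j -> [/\ far (x :: s i) (a j :: t j), far (x :: s i) (a j :: r j)
                           & far (a i :: t i) (a j :: r j)]) ->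
  False.
Proof.
move=> hs ht hr hfar.
pose g i := s i ++ t i.
have pg i : path lstep x (g i).
  by have [h1 h2] := hs i; have [h3 _] := ht i; rewrite cat_path h1 h2.
have lg i : last x (g i) = y by rewrite last_cat (hs i).2 (ht i).2.
pose W i z := winding (trail x (g i)) z.
have gE i z u : crossing (trail x (g i)) (trail z u) =
    crossing (trail x (s i)) (trail z u) (+) crossing (trail (a i) (t i)) (trail z u).
  by rewrite /g trail_cat (hs i).2 crossing_catl.
(* The walk [r i] is far from the closed curve made of [g j] and [g k], so its two ends have the
   same winding parity. *)
have e1 i j k : j != i -> k != i ->
    W j (a i) (+) W j w (+) (W k (a i) (+) W k w) = false.
  move=> ji ki; have [hr1 hr2] := hr i; rewrite -hr2 winding_move2 ?lg // !gE.
  have [_ f1 f2] := hfar _ _ ji; have [_ f3 f4] := hfar _ _ ki.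
  by rewrite !far_crossing ?(hs _).1 ?(ht _).1.
(* Along [s i] that closed curve can be crossed only in its parts [s j] and [s k]. *)
have e2 i j k : j != i -> k != i -> W j x (+) W j (a i) (+) (W k x (+) W k (a i)) =
   crossing (trail x (s j)) (trail x (s i)) (+) crossing (trail x (s k)) (trail x (s i)).
  move=> ji ki; have [hr1 hr2] := hs i; rewrite -{1 2}hr2 winding_move2 ?lg // !gE.
  have f b : b != i -> crossing (trail (a b) (t b)) (trail x (s i)) = false.
    rewrite eq_sym => ib; apply: far_crossing; rewrite ?(ht _).1 ?(hs _).1 // => p q hp hq.
    by rewrite near_sym; have [f _ _] := hfar i b ib; apply: f.
  by rewrite !f // !addbF.
have e3 i j : i != j -> crossing (trail x (s i)) (trail x (s j)) (+)
    crossing (trail x (s j)) (trail x (s i)) =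
    ~~ (corner (trail x (s i)) x (+) corner (trail x (s j)) x).
  have f b c : b != c -> last x (s b) \notin x :: s c.
    rewrite eq_sym => cb; have [f _ _] := hfar c b cb.
    apply/negP => h; have := f _ (a b) h (mem_head _ _).
    by rewrite (hs b).2 nearxx.
  by move=> ij; apply: crossing_swap; rewrite ?(hs _).1 ?f // eq_sym.
pose i0 : 'I_3 := ord0; pose i1 : 'I_3 := Ordinal (isT : 1 < 3).
pose i2 : 'I_3 := Ordinal (isT : 2 < 3).
pose d i := W i x (+) W i w; pose c i j := crossing (trail x (s i)) (trail x (s j)).
have e4 i j k : j != i -> k != i -> d j (+) d k = c j i (+) c k i.
  move=> ji ki; rewrite -(e2 i j k ji ki) /d; move: (e1 i j k ji ki).
  by case: (W j x) (W j w) (W k x) (W k w) (W j (a i)) (W k (a i)) => [] [] [] [] [] [].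
pose n i := corner (trail x (s i)) x.
(* In the three equations [e4] each [d i] occurs twice, so the sum of [c i j] over ordered pairs is
   even. In the three equations [e3] each [n i] occurs twice, so the same sum is odd. *)
have {e1 e2 e4} := (e4 i0 i1 i2 isT isT, e4 i1 i0 i2 isT isT, e4 i2 i0 i1 isT isT).
have {e3} := (e3 i0 i1 isT, e3 i0 i2 isT, e3 i1 i2 isT); rewrite -!/(c _ _) -!/(n _).
case: (n i0) (n i1) (n i2) => [] [] [] /=; case: (d i0) (d i1) (d i2) => [] [] [] /=;
case: (c i0 i1) (c i1 i0) => [] [] [[]] //= _; case: (c i0 i2) (c i2 i0) => [] [] //= _;
by case: (c i1 i2) (c i2 i1) => [] [] //= _ [[]].
Qed.

(** * Theta graphs in lattice drawings *)

Definition inner_edge (G : sgraph) (R : {set G}) : rel G :=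
  [rel u v | [&& sedge u v, u \in R & v \in R]].

Definition connected_in (G : sgraph) (R : {set G}) : Prop :=
  {in R &, forall u v, connect (inner_edge R) u v}.

(** Edges with a common vertex may overlap after rounding, so distance is demanded of independent
    edges only. *)
Record lattice_drawing (G : sgraph) (node : G -> point) (line : G -> G -> seq point) : Prop :=
  LatticeDrawing {
    line_path : forall u v, sedge u v -> path lstep (node u) (line u v);
    line_last : forall u v, sedge u v -> last (node u) (line u v) = node v;
    lines_far : forall u v u' v', sedge u v -> sedge u' v' ->
      u \notin [:: u'; v'] -> v \notin [:: u'; v'] ->
      far (node u :: line u v) (node u' :: line u' v') }.

Section Theta.
Variables (G : sgraph) (node : G -> point) (line : G -> G -> seq point).
Hypothesis drawn : lattice_drawing node line.

Fixpoint draw (u : G) (s : seq G) : seq point :=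
  if s is v :: s' then line u v ++ draw v s' else [::].

Lemma draw_path u s : path sedge u s ->
  path lstep (node u) (draw u s) /\ last (node u) (draw u s) = node (last u s).
Proof.
elim: s u => //= v s IH u /andP[uv /IH[h1 h2]].
by rewrite cat_path last_cat (line_last drawn) // (line_path drawn).
Qed.

Lemma mem_draw u v s p : path sedge u (v :: s) -> p \in node u :: draw u (v :: s) ->
  exists a b, [/\ sedge a b, a \in u :: v :: s, b \in u :: v :: s & p \in node a :: line a b].
Proof.
elim: s u v => [|v' s IH] u v.
  rewrite /= cats0 andbT => uv h; exists u, v; split => //; by rewrite !inE eqxx ?orbT.
move=> /= /andP[uv h].
rewrite -cat_cons mem_cat => /orP[hp|hp].
  by exists u, v; split => //; rewrite !inE eqxx ?orbT.
have [|a [b [ab ha hb hp']]] := IH v v' h.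
  by rewrite in_cons /= hp orbT.
by exists a, b; split => //; rewrite in_cons ?ha ?hb orbT.
Qed.

Lemma draw_far u s u' s' : s != [::] -> s' != [::] -> path sedge u s -> path sedge u' s' ->
  ~~ has [in u :: s] (u' :: s') -> far (node u :: draw u s) (node u' :: draw u' s').
Proof.
case: s => [//|v s] _; case: s' => [//|v' s'] _ h h' /hasPn d p q hp hq.
have [a [b [ab ha hb hp']]] := mem_draw h hp.
have [a' [b' [ab' ha' hb' hq']]] := mem_draw h' hq.
have {}d c : c \in u :: v :: s -> c \notin [:: a'; b'].
  move=> hc; rewrite !inE negb_or; apply/andP.
  by split; apply/eqP => e; [move: (d _ ha')|move: (d _ hb')]; rewrite -e hc.
exact: (lines_far drawn ab ab' (d _ ha) (d _ hb) hp' hq').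
Qed.

Lemma connected_in_path (R : {set G}) u v : connected_in R -> u \in R -> v \in R ->
  exists s, [/\ path sedge u s, last u s = v & {subset s <= R}].
Proof.
move=> cR uR vR; have /connectP[s hs ->] := cR u v uR vR.
exists s; split=> //; first by apply: sub_path hs => a b /and3P[].
elim: s u uR hs => //= z s IH u uR /andP[/and3P[_ _ zR] hs] t; rewrite inE => /predU1P[->//|].
exact: IH zR hs t.
Qed.

(** A vertex w of R, joined through R to a vertex [a i] of each of the three paths, yields K33 with
    sides x, y, w and [a 0], [a 1], [a 2]. The walks through R may overlap one another because they
    all end in w. *)
Lemma no_attached_theta (x y : G) (A : 'I_3 -> seq G) (R : {set G}) :
  x != y ->
  (forall i, [/\ path sedge x (rcons (A i) y), x \notin A i & y \notin A i]) ->
  (forall i j, i != j -> ~~ has [in A i] (A j)) ->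
  connected_in R -> x \notin R -> y \notin R -> (forall i a, a \in A i -> a \notin R) ->
  (forall i, exists a z, [/\ a \in A i, z \in R & sedge a z]) -> False.
Proof.
move=> xy hA dA cR xR yR AR att.
have [_ [w [_ wR _]]] := att ord0.
have H i : exists d : G * (seq G * seq G * seq G), let: (a, (s, t, r)) := d in
  [/\ A i = rcons s a ++ t, path sedge a r, last a r = w & r != [::]] /\ {subset r <= R}.
  have [a [z [aA zR az]]] := att i.
  have [r [h1 h2 h3]] := connected_in_path cR zR wR.
  case/splitPr: aA => s t; exists (a, (s, t, z :: r)); rewrite cat_rcons; split; first split=> //=.
    by rewrite az.
  by move=> q; rewrite inE => /predU1P[->|/h3].
have [D hD] := fin_all_exists H.
pose a i := (D i).1; pose s i := (D i).2.1.1; pose t i := (D i).2.1.2; pose r i := (D i).2.2.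
have {H}hD i : [/\ A i = rcons (s i) (a i) ++ t i, path sedge (a i) (r i), last (a i) (r i) = w
    & r i != [::]] /\ {subset r i <= R}.
  by have := hD i; rewrite /a /s /t /r; case: (D i) => a' [[]].
have ps i : path sedge x (rcons (s i) (a i)) /\ path sedge (a i) (rcons (t i) y).
  have [[e _ _ _] _] := hD i; have [h _ _] := hA i.
  by move: h; rewrite e rcons_cat cat_path last_rcons => /andP.
have aA i : a i \in A i by have [[-> _ _ _] _] := hD i; rewrite mem_cat mem_rcons mem_head.
have sA i v : v \in a i :: s i -> v \in A i.
  by have [[-> _ _ _] _] := hD i; rewrite mem_cat mem_rcons => ->.
have tA i v : v \in t i -> v \in A i.
  by have [[-> _ _ _] _] := hD i; rewrite mem_cat => ->; rewrite orbT.
have rR i v : v \in r i -> v \in R by have [_ h] := hD i; apply: h.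
apply: (@no_lattice_K33 (node x) (node y) (node w) (fun i => node (a i))
  (fun i => draw x (rcons (s i) (a i))) (fun i => draw (a i) (rcons (t i) y))
  (fun i => draw (a i) (r i))).
- by move=> i; have [h _] := ps i; have := draw_path h; rewrite last_rcons.
- by move=> i; have [_ h] := ps i; have := draw_path h; rewrite last_rcons.
- by move=> i; have [[_ h1 <- _] _] := hD i; apply: draw_path.
move=> i j ij; have [s1 s2] := ps i; have [s3 s4] := ps j.
have [[_ h1 _ h2] _] := hD j.
have dis v : v \in A i -> v \in A j -> False.
  by move=> hi hj; have /hasPn/(_ v hj)/negP := dA _ _ ij; apply.
have [_ xi yi] := hA i; have [_ xj yj] := hA j.
have nr (q : seq G) v : rcons q v != [::] by case: q.
have ne (v v' : G) (p : pred G) : v \notin p -> v' \in p -> v == v' = false.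
  by move=> hv hv'; apply/negbTE; apply: contraNneq hv => ->.
have inA v : v \in a j :: t j -> v \in A j by rewrite inE => /predU1P[->|/tA].
have inA' v : v \in a i :: t i -> v \in A i by rewrite inE => /predU1P[->|/tA].
have mR v : v \in A i -> v \in r j -> False.
  by move=> /AR/negP h /rR.
split; apply: draw_far => //; apply/hasPn => v; rewrite !inE ?mem_rcons.
- rewrite inE orbCA => /orP[/eqP->|hv].
    by rewrite negb_or eq_sym xy; apply/negP => /sA; apply/negP.
  rewrite negb_or; apply/andP; split.
    by apply/eqP => e; move: (inA v hv); rewrite e; apply/negP.
  by apply/negP => /sA /dis; apply; apply: inA.
- move=> hv; rewrite negb_or; apply/andP; split.
    case/orP: hv => [/eqP->|/rR hv]; first by apply/eqP => e; move: (aA j); rewrite e; apply/negP.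
    by apply/eqP => e; move: hv; rewrite e; apply/negP.
  apply/negP => /sA h; case/orP: hv => [/eqP e|/mR]; last exact.
  by apply: dis h _; rewrite e.
- move=> hv; rewrite inE orbCA; apply/negP => /orP[/eqP e|h].
    case/orP: hv => [/eqP e'|/rR hv]; first by move: (aA j); rewrite -e' e; apply/negP.
    by move: hv; rewrite e; apply/negP.
  have {h} h := inA' v h.
  by case/orP: hv => [/eqP e|/mR]; [apply: dis h _; rewrite e|apply].
Qed.

End Theta.

(** * From plane drawings to lattice drawings *)

Section UnitIntervalCurves.
Variables (R : realType) (V : normedModType R).
Local Open Scope ring_scope.
Local Open Scope classical_set_scope.

Lemma within_continuous_eps (A : set R) (g : R -> V) : {within A, continuous g} ->
  forall x, A x -> forall e, 0 < e ->
  exists2 d, 0 < d & forall t, A t -> `|x - t| < d -> `|g x - g t| < e.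
Proof.
move=> /subspace_continuousP gc x Ax e e0.
have /cvgrPdist_lt /(_ e e0) := gc x Ax.
rewrite /prop_near1 /within /= => /nbhs_ballP[d d0 hd].
by exists d => // t At xt; apply: hd.
Qed.

Lemma uniformly_continuous (A : set R) (g : R -> V) : compact A -> {within A, continuous g} ->
  forall e, 0 < e ->
  exists2 d, 0 < d & forall s t, A s -> A t -> `|s - t| < d -> `|g s - g t| < e.
Proof.
move=> /compact_near_coveringP cA gc e e0.
have := cA _ (0 : R)^'+ (fun d s => A s -> forall t, A t -> `|s - t| < d -> `|g s - g t| < e) _.
case=> [x Ax|d d0 hd].
  have [d d0 hd] := within_continuous_eps gc Ax (divr_gt0 e0 (ltr0n _ 2)).
  have d2 : 0 < d / 2 by rewrite divr_gt0.
  near=> s i => /= As t At st.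
  have sx : `|x - s| < d / 2 by near: s; exact: nbhsx_ballx.
  have id : i < d / 2 by near: i; exact: nbhs_right_lt.
  have xt : `|x - t| < d by have := ler_normD (x - s) (s - t); rewrite subrKA; lra.
  have := ler_normD (g s - g x) (g x - g t); rewrite subrKA [`|g s - g x|]distrC.
  have := hd t At xt; have := hd s As (_ : `|x - s| < d); lra.
have d2 : 0 < d / 2 by rewrite divr_gt0.
exists (d / 2) => // s t As At; apply: (hd _ _ _ s As As t At) => //=.
by rewrite sub0r normrN gtr0_norm //= gtr_pMr // invf_lt1 // ltr1n.
Unshelve. all: by end_near.
Qed.

Lemma disjoint_curves_apart (A : set R) (g h : R -> V) : compact A ->
  {within A, continuous g} -> {within A, continuous h} ->
  (forall s t, A s -> A t -> g s <> h t) ->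
  exists2 d, 0 < d & forall s t, A s -> A t -> d < `|g s - h t|.
Proof.
move=> cA gc hc dis.
have cB : topology_structure.closed (h @` A).
  by apply: compact_closed; [exact: norm_hausdorff|exact: continuous_compact].
have /compact_near_coveringP nA := cA.
have := nA _ (0 : R)^'+ (fun d s => A s -> forall t, A t -> d < `|g s - h t|) _.
case=> [x Ax|d d0 hd].
  have [d d0 hd] : exists2 d, 0 < d & forall t, A t -> d <= `|g x - h t|.
    have : nbhs (g x) (~` (h @` A)).
      apply: open_nbhs_nbhs; split; first exact: closed_openC.
      by move=> [t At e]; apply: (dis x t).
    move=> /nbhs_ballP[d /= d0 hd]; exists d => // t At; rewrite leNgt; apply/negP => c.
    by apply: (hd (h t)); [rewrite -ball_normE|exists t].
  have d2 : 0 < d / 2 by rewrite divr_gt0.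
  have [f f0 hf] := within_continuous_eps gc Ax d2.
  near=> s i => /= As t At.
  have sx : `|x - s| < f by near: s; exact: nbhsx_ballx.
  have id : i < d / 2 by near: i; exact: nbhs_right_lt.
  have := hf s As sx; have := hd t At.
  have := ler_normD (g x - g s) (g s - h t); rewrite subrKA; lra.
have d2 : 0 < d / 2 by rewrite divr_gt0.
exists (d / 2) => // s t As At; apply: (hd _ _ _ s As As t At) => //=.
by rewrite sub0r normrN gtr0_norm //= gtr_pMr // invf_lt1 // ltr1n.
Unshelve. all: by end_near.
Qed.

End UnitIntervalCurves.

(** Consecutive points may differ diagonally, so a corner is inserted between them. *)
Lemma lattice_walk (f : nat -> point) (M : nat) :
  (forall k, k < M -> near 1 (f k) (f k.+1)) ->
  exists s, [/\ path lstep (f 0) s, last (f 0) s = f M &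
             forall p, p \in f 0 :: s -> exists2 k, k <= M & near 1 p (f k)].
Proof.
elim: M => [|M IH] hf.
  exists [::]; split=> // p; rewrite inE => /eqP->; exists 0 => //; exact: nearxx.
have [s [h1 h2 h3]] := IH (fun k kM => hf k (leqW kM)).
exists (s ++ [:: ((f M.+1).1, (f M).2); f M.+1]); rewrite last_cat; split=> //.
  rewrite cat_path h1 h2 /= andbT /lstep /near /= !eqxx !orbT !andbT.
  by have := hf M (leqnn _); rewrite /near; lia.
move=> p; rewrite -cat_cons mem_cat => /orP[/h3[k kM hk]|]; first by exists k; rewrite 1?leqW.
rewrite !inE => /orP[|] /eqP->; exists M.+1; rewrite ?nearxx //.
by have := hf M (leqnn _); rewrite /near /=; lia.
Qed.

Section Discretization.
Variable R : realType.
Local Open Scope ring_scope.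
Local Open Scope classical_set_scope.

Definition cell (N : R) (x : R * R) : point := (Num.floor (N * x.1), Num.floor (N * x.2)).

Lemma floor_near (a b : R) : `|a - b| <= 1 -> (`|Num.floor a - Num.floor b| <= 1)%N.
Proof.
have /andP[h1 h2] := floor_itv a; have /andP[h3 h4] := floor_itv b.
rewrite ler_norml => /andP[h5 h6].
have : ((Num.floor a)%:~R < (Num.floor b + 1 + 1)%:~R :> R) by rewrite !intrD; lra.
have : ((Num.floor b)%:~R < (Num.floor a + 1 + 1)%:~R :> R) by rewrite !intrD; lra.
by rewrite !ltr_int; lia.
Qed.

Lemma cell_near (N : R) (x y : R * R) : 0 < N -> N * `|x - y| <= 1 -> near 1 (cell N x) (cell N y).
Proof.
move=> N0 h; rewrite /near /cell /=.
by apply/andP; split; apply: floor_near; rewrite -mulrBr normrM gtr0_norm //;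
  apply: le_trans h; rewrite ler_pM2l // prod_normE le_max lexx ?orbT.
Qed.

Lemma near_floor (a b : R) (d : nat) :
  (`|Num.floor a - Num.floor b| <= d)%N -> `|a - b| <= (d.+1)%:R.
Proof.
have /andP[h1 h2] := floor_itv a; have /andP[h3 h4] := floor_itv b => h.
have : ((Num.floor a + 1)%:~R <= (Num.floor b + d.+1%:Z)%:~R :> R) by rewrite ler_int; lia.
have : ((Num.floor b + 1)%:~R <= (Num.floor a + d.+1%:Z)%:~R :> R) by rewrite ler_int; lia.
by rewrite ler_norml !intrD -pmulrn => h5 h6; apply/andP; split; lra.
Qed.

Lemma near_cell (N : R) (x y : R * R) d : 0 < N -> near d (cell N x) (cell N y) ->
  N * `|x - y| <= d.+1%:R.
Proof.
move=> N0 /andP[/near_floor h1 /near_floor h2].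
move: h1 h2; rewrite /cell /= -!mulrBr !normrM gtr0_norm // prod_normE /=.
by case: (leP `|x.1 - y.1| `|x.2 - y.2|).
Qed.

Lemma curve_walk (g : R -> R * R) (N : R) : {within `[0, 1], continuous g} -> 0 < N ->
  exists s, [/\ path lstep (cell N (g 0)) s, last (cell N (g 0)) s = cell N (g 1) &
    forall p, p \in cell N (g 0) :: s -> exists2 t, t \in `[0, 1] & near 1 p (cell N (g t))].
Proof.
move=> gc N0.
have N1 : 0 < N^-1 by rewrite invr_gt0.
have [d d0 hd] := uniformly_continuous (@segment_compact R 0 1) gc N1.
pose M := (Num.truncn d^-1).+1.
have M0 : 0 < M%:R :> R by rewrite ltr0n.
have Md : M%:R^-1 < d.
  by rewrite invf_plt ?posrE // /M; exact: truncnS_gt.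
pose f k := cell N (g (k%:R / M%:R)).
have in01 k : (k <= M)%N -> (k%:R / M%:R : R) \in `[0, 1].
  by move=> kM; rewrite classical_sets.inE /= in_itv /=; apply/andP; split; [exact: divr_ge0 | rewrite ler_pdivrMr // mul1r ler_nat].
have hf k : (k < M)%N -> near 1 (f k) (f k.+1).
  move=> kM; apply: cell_near => //; rewrite -[leRHS](mulfV (lt0r_neq0 N0)) ler_pM2l //.
  apply/ltW/hd; [exact/set_mem/in01/ltnW|exact/set_mem/in01|].
  by rewrite -mulrBl -natr1 opprD addrA subrr sub0r mulN1r normrN gtr0_norm ?invr_gt0.
have [s] := lattice_walk hf; rewrite /f mul0r divff ?gt_eqF // => -[h1 h2 h3].
by exists s; split=> // p /h3[k kM hk]; exists (k%:R / M%:R); first exact: in01.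
Qed.

Lemma planar_lattice_drawing (G : sgraph) : planar R G ->
  exists node line, @lattice_drawing G node line.
Proof.
case=> pt [arc D].
have dis u v u' v' : sedge u v -> sedge u' v' -> u \notin [:: u'; v'] -> v \notin [:: u'; v'] ->
    forall s t, s \in `[0, 1] -> t \in `[0, 1] -> arc u v s <> arc u' v' t.
  move=> uv uv' hu hv s t.
  have end_or_inner (r : R) : r \in `[0, 1] -> [\/ r = 0, r = 1 | (r \in `]0, 1[)].
    rewrite !classical_sets.inE /= !in_itv /= => /andP[r0 r1]; have [->|n0] := eqVneq r 0; first exact: Or31.
    have [->|n1] := eqVneq r 1; first exact: Or32.
    by apply: Or33; rewrite !lt_neqAle r0 r1 n1 eq_sym n0.
  have at_vertex a b r : sedge a b -> r \in `[0, 1] ->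
      (r \in `]0, 1[) \/ exists2 c, c \in [:: a; b] & arc a b r = pt c.
    move=> ab /end_or_inner[->|->|]; [right|right|by left].
      by exists a; rewrite ?mem_head // (arc_source D).
    by exists b; rewrite ?inE ?eqxx ?orbT // (arc_target D).
  move=> /(at_vertex _ _ _ uv)[hs|[c hc ->]] /(at_vertex _ _ _ uv')[ht|[c' hc' ->]].
  - move=> /(arcs_do_not_cross D uv uv' hs ht)[] [e1 e2].
      by move: hu; rewrite e1 mem_head.
    by move: hu; rewrite e2 !inE eqxx orbT.
  - by apply: (arc_avoids_vertices D).
  - by move=> e; apply: (arc_avoids_vertices D uv' ht); rewrite -e.
  - move=> /(pt_inj D) e; subst c'.
    by move: hc; rewrite !inE => /orP[|] /eqP e; [move: hu|move: hv]; rewrite -e hc'.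
have sep (q : (G * G) * (G * G)) : exists d : R, 0 < d /\
    (sedge q.1.1 q.1.2 -> sedge q.2.1 q.2.2 ->
     q.1.1 \notin [:: q.2.1; q.2.2] -> q.1.2 \notin [:: q.2.1; q.2.2] ->
     forall s t, s \in `[0, 1] -> t \in `[0, 1] ->
     d < `|arc q.1.1 q.1.2 s - arc q.2.1 q.2.2 t|).
  case: q => [[u v] [u' v']] /=.
  have [/and4P[uv uv' hu hv]|no] :=
    boolP [&& sedge u v, sedge u' v', u \notin [:: u'; v'] & v \notin [:: u'; v']].
    have [d d0 hd] := disjoint_curves_apart (@segment_compact R 0 1)
      (arc_continuous D uv) (arc_continuous D uv')
      (fun s t hs ht => dis _ _ _ _ uv uv' hu hv s t (mem_set hs) (mem_set ht)).
    by exists d; split=> // _ _ _ _ s t /set_mem hs /set_mem; apply: hd.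
  by exists 1; split=> // a b c e; rewrite a b c e in no.
have [d hd] := fin_all_exists sep.
(* Points of the lattice walks are within 1 of cells of their curves. If two of them were within 1
   of each other, these cells would be within 3, hence the curves within 4 / N by [near_cell]; N
   makes this at most each separation [d q]. *)
pose N := 1 + \sum_q 4 / d q.
have dN q : 4 <= N * d q.
  have [d0 _] := hd q; rewrite -ler_pdivrMr // /N (bigD1 q) //=.
  rewrite addrCA lerDl addr_ge0 // sumr_ge0 // => i _.
  by rewrite divr_ge0 // ltW //; have [] := hd i.
have N0 : 0 < N.
  by rewrite /N ltr_pwDl // sumr_ge0 // => i _; rewrite divr_ge0 // ltW //; have [] := hd i.
have walk (e : G * G) : exists s, sedge e.1 e.2 ->
    [/\ path lstep (cell N (pt e.1)) s, last (cell N (pt e.1)) s = cell N (pt e.2) &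
    forall p, p \in cell N (pt e.1) :: s ->
      exists2 t, t \in `[0, 1] & near 1 p (cell N (arc e.1 e.2 t))].
  case: e => [u v] /=; have [uv|_] := boolP (sedge u v); last by exists [::].
  have [s] := curve_walk (arc_continuous D uv) N0.
  by rewrite (arc_source D) // (arc_target D) // => hs; exists s.
have [w hw] := fin_all_exists walk.
exists (fun v => cell N (pt v)), (fun u v => w (u, v)); split.
- by move=> u v uv; have [] := hw (u, v) uv.
- by move=> u v uv; have [] := hw (u, v) uv.
move=> u v u' v' uv uv' hu hv p q hp hq; apply/negP => pq.
have [_ _ /(_ p hp)[s hs ps]] := hw (u, v) uv; have [_ _ /(_ q hq)[t ht qt]] := hw (u', v') uv'.
have [_ far] := hd ((u, v), (u', v')).
have {}far := far uv uv' hu hv s t hs ht.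
have : near (1 + 1 + 1) (cell N (arc u v s)) (cell N (arc u' v' t)).
  by apply: near_trans qt; apply: near_trans pq; rewrite near_sym.
move=> /(near_cell N0); apply/negP; rewrite -ltNge.
by apply: le_lt_trans (dN ((u, v), (u', v'))) _; rewrite ltr_pM2l.
Qed.

End Discretization.

(** * The game as a finite game tree *)

Section Game.
Variable G : sgraph.
Implicit Types (c s : seq G) (r x : G).

Lemma stepxx (x : G) : step x x.
Proof. by rewrite /step eqxx. Qed.

Lemma all2_stepxx c : all2 (@step G) c c.
Proof. by elim: c => //= x c ->; rewrite stepxx. Qed.

Lemma all2_cat (c c' d d' : seq G) : all2 (@step G) c c' -> all2 (@step G) d d' ->
  all2 (@step G) (c ++ d) (c' ++ d').
Proof. by elim: c c' => [[]|x c IH [|y c']] //= /andP[-> /IH{}IH /IH]. Qed.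

Lemma all2_step_size c c' : all2 (@step G) c c' -> size c = size c'.
Proof. by rewrite all2E => /andP[/eqP]. Qed.

(* Robber to move; no play is left to him: he is caught in a finite game tree *)
(* whose leaves are the positions without a legal robber move.                *)
Inductive robber_loses : seq G -> G -> Prop :=
  RobberLoses c r (answer : G -> seq G) of
    (forall x, step r x -> x \notin c -> all2 (@step G) c (answer x)) &
    (forall x, step r x -> x \notin c -> robber_loses (answer x) x) : robber_loses c r.

Lemma robber_losesI c r :
  (forall x, step r x -> x \notin c -> exists2 c', all2 (@step G) c c' & robber_loses c' x) ->
  robber_loses c r.
Proof.
move=> h; have /fin_all_exists[f hf] x : exists c', step r x -> x \notin c ->
    all2 (@step G) c c' /\ robber_loses c' x.
  have [/andP[h1 h2]|no] := boolP (step r x && (x \notin c)).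
    by have [c' h3 h4] := h x h1 h2; exists c'.
  by exists c => h1 h2; rewrite h1 h2 in no.
by apply: (@RobberLoses c r f) => x h1 h2; have [] := hf x h1 h2.
Qed.

Lemma all2_nth x0 c c' i : all2 (@step G) c c' -> step (nth x0 c i) (nth x0 c' i).
Proof.
elim: c c' i => [[|//] i _|x c IH [|y c'] [|i]] //=; first by rewrite !nth_nil stepxx.
  by case/andP.
by case/andP => _; apply: IH.
Qed.

Lemma all2_maps (I : eqType) (f g : I -> G) (t : seq I) :
  (forall i, i \in t -> step (f i) (g i)) -> all2 (@step G) (map f t) (map g t).
Proof.
elim: t => //= i t IH h; rewrite h ?mem_head //=; apply: IH => j jt.
by apply: h; rewrite in_cons jt orbT.
Qed.

Lemma perm_eq_all2 c d c' : perm_eq c d -> all2 (@step G) c c' ->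
  exists2 d', perm_eq c' d' & all2 (@step G) d d'.
Proof.
case: c => [|x0 c0]; last set c := x0 :: c0.
  by move=> /perm_size /esym /size0nil ->; case: c' => // _; exists [::].
rewrite perm_sym => /(perm_iotaP x0)[Is pI ->] st.
exists [seq nth x0 c' i | i <- Is].
  rewrite perm_sym; apply: perm_trans (perm_map (nth x0 c') pI) _.
  by rewrite (all2_step_size st) -/(mkseq _ _) mkseq_nth.
by apply: all2_maps => i _; apply: all2_nth.
Qed.

(** Cops are interchangeable, so they can swap roles when a position is read as one of another
    kind. *)
Lemma robber_loses_perm c d r : perm_eq c d -> robber_loses c r -> robber_loses d r.
Proof.
move=> cd h; elim: h d cd => {}c {}r f h1 _ IH d cd.
apply: robber_losesI => x rx xd; have xc : x \notin c by rewrite (perm_mem cd).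
have [d' h3 h4] := perm_eq_all2 cd (h1 x rx xc).
by exists d' => //; apply: IH.
Qed.

(** A rank on lost positions, from which a positional strategy can be chosen. *)
Fixpoint loses_within (n : nat) c r : Prop :=
  if n is n'.+1 then forall x, step r x -> x \notin c ->
    exists2 c', all2 (@step G) c c' & loses_within n' c' x
  else False.

Lemma loses_withinW n m c r : n <= m -> loses_within n c r -> loses_within m c r.
Proof.
elim: n m c r => [//|n IH] [|m] //= c r nm h x rx xc.
by have [c' h1 h2] := h x rx xc; exists c' => //; apply: IH h2.
Qed.

Lemma robber_loses_within c r : robber_loses c r -> exists n, loses_within n c r.
Proof.
elim=> {}c {}r f h1 _ IH.
have /fin_all_exists[N hN] x : exists n, step r x -> x \notin c -> loses_within n (f x) x.
  have [/andP[rx xc]|no] := boolP (step r x && (x \notin c)).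
    by have [n hn] := IH x rx xc; exists n.
  by exists 0 => rx xc; rewrite rx xc in no.
exists (\max_x N x).+1 => x rx xc; exists (f x); first exact: h1.
by apply: loses_withinW (hN x rx xc); apply: leq_bigmax.
Qed.

(** From each position the cops choose an answer of least rank. The rank falls in every round, so no
    infinite legal play against this strategy exists. *)
Lemma cops_win_of_robber_loses (c0 : seq G) :
  (forall r, exists2 c, all2 (@step G) c0 c & robber_loses c r) -> cops_win G (size c0).
Proof.
set m := size c0 => win.
pose good n (c : placement G m) x (c' : placement G m) :=
  (forall i, step (c i) (c' i)) /\ loses_within n (codom c') x.
have goodI n (c : placement G m) x s :
    all2 (@step G) (codom c) s -> loses_within n s x ->
    exists c' : placement G m, good n c x c'.
  have nthE (d : placement G m) (i : 'I_m) : nth x (codom d) i = d i.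
    by rewrite codomE (nth_map i) ?size_enum_ord // nth_ord_enum.
  move=> st hs; pose c' : placement G m := [ffun i : 'I_m => nth x s i].
  have sz : size s = m by rewrite -(all2_step_size st) size_codom card_ord.
  have ec : codom c' = s.
    apply: (@eq_from_nth _ x); rewrite size_codom card_ord // => i im.
    by rewrite (nthE _ (Ordinal im)) ffunE.
  exists c'; split; last by rewrite ec.
  move=> i; rewrite ffunE; have := all2_nth x i st.
  by rewrite nthE.
have /choice[next hnext] (cx : placement G m * G) : exists c' : placement G m, (forall i, step (cx.1 i) (c' i)) /\
    forall n, (exists c'' : placement G m, good n cx.1 cx.2 c'') -> exists2 n', n' <= n & good n' cx.1 cx.2 c'.
  case: cx => c x /=.
  have [[n [c' h]]|no] := pselect (exists n, exists c' : placement G m, good n c x c'); last first.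
    exists c; split=> [i|n h]; first exact: stepxx.
    by case: no; exists n.
  have ex : exists n, `[< exists c' : placement G m, good n c x c' >] by exists n; apply/asboolP; exists c'.
  case: (ex_minnP ex) => n0 /asboolP[c0' h0] hmin; exists c0'; split; first by case: h0.
  by move=> n' hn'; exists n0 => //; apply: hmin; apply/asboolP.
pose p0 : placement G m := [ffun i : 'I_m => tnth (in_tuple c0) i].
have ep0 : codom p0 = c0.
  by rewrite codomE (eq_map (ffunE _)) map_tnth_enum.
exists (foldl (fun (p : placement G m) x => next (p, x)) p0); split.
  move=> h x i; rewrite foldl_rcons; have [h1 _] := hnext (foldl (fun (p : placement G m) x => next (p, x)) p0 h, x).
  exact: h1.
move=> r legal; exfalso.
have cS n : cops_at (foldl (fun (p : placement G m) x => next (p, x)) p0) r n.+1 =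
    next (cops_at (foldl (fun (p : placement G m) x => next (p, x)) p0) r n, r n).
  by rewrite /cops_at mkseqS foldl_rcons.
move: legal cS; set S := cops_at _ r => legal cS.
have S0 : S 0 = p0 by [].
have progress k n : loses_within k (codom (S n.+1)) (r n) -> False.
  elim/ltn_ind: k n => [] [|k] IH n h; first by case: h.
  move: h => /= h.
  have [h1 h2] := legal n.
  have [|s st hs] := h (r n.+1) h1.
    apply: contra h2 => /codomP[i ->]; apply/existsP; exists i; exact: eqxx.
  have [_ /(_ k (goodI _ _ _ _ st hs))[k' kk [_ hk]]] := hnext (S n.+1, r n.+1).
  by apply: (IH k' _ n.+1); [rewrite ltnS | rewrite cS].
have [s st /robber_loses_within[n hs]] := win (r 0).
have [_ /(_ n)] := hnext (p0, r 0).
case=> [|k _ [_ hk]]; first by apply: goodI hs; rewrite /= ep0.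
by apply: (progress k 0); rewrite cS S0.
Qed.

End Game.

(** * Components and walks inside a territory *)

Section Territory.
Variable G : sgraph.
Implicit Types (R D : {set G}) (v x y r : G).

Definition attached R v : bool := [exists z in R, sedge v z].

Lemma attachedI R v z : z \in R -> sedge v z -> attached R v.
Proof. by move=> zR vz; apply/existsP; exists z; rewrite zR. Qed.

Lemma attachedP R v : reflect (exists2 z, z \in R & sedge v z) (attached R v).
Proof.
apply: (iffP existsP) => [[z /andP[h1 h2]]|[z h1 h2]]; first by exists z.
by exists z; rewrite h1.
Qed.

Lemma attachedW R R' v : R \subset R' -> attached R v -> attached R' v.
Proof. by move=> /subsetP s /attachedP[z /s zR vz]; apply: attachedI vz. Qed.

Definition component D r : {set G} := [set z | connect (inner_edge D) r z].

Lemma component_refl D r : r \in component D r.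
Proof. by rewrite inE connect0. Qed.

Lemma component_sub D r : r \in D -> component D r \subset D.
Proof.
move=> rD; apply/subsetP => z; rewrite inE => /connectP[s + ->].
by elim: s r rD => //= a s IH r rD /andP[/and3P[_ _ aD]]; apply: IH.
Qed.

Lemma inner_edge_sym D : symmetric (inner_edge D).
Proof. by move=> u v; rewrite /inner_edge /= sedge_sym [(u \in D) && _]andbC. Qed.

Lemma component_connected D r : connected_in (component D r).
Proof.
suff H z : z \in component D r -> connect (inner_edge (component D r)) r z.
  move=> u v /H hu /H hv; apply: connect_trans hv.
  by rewrite (sym_connect_sym (@inner_edge_sym _)).
set C := component D r; have aC a b : b \in C -> inner_edge D b a -> a \in C.
  rewrite !inE => bC ba; exact (connect_trans bC (connect1 ba)).
rewrite {1}/C inE => /connectP[s hs ->].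
suff H b : b \in C -> path (inner_edge D) b s -> connect (inner_edge C) b (last b s).
  exact: H (component_refl D r) hs.
elim: s b {hs} => [|a s IH] b bC /= hs; first exact: connect0.
case/andP: hs => ba hs; refine (connect_trans (connect1 _) (IH a (aC _ _ bC ba) hs)).
by rewrite /inner_edge /= bC (aC _ _ bC ba) !andbT; case/and3P: ba.
Qed.

Lemma component_closed D r z y : r \in D -> z \in component D r -> sedge z y -> y \in D ->
  y \in component D r.
Proof.
move=> rD zC zy yD; rewrite inE; have zD := subsetP (component_sub rD) _ zC.
by rewrite inE in zC; refine (connect_trans zC (connect1 _)); rewrite /inner_edge /= zy zD yD.
Qed.

Lemma component_attached R D r q : connected_in R -> D \subset R -> r \in D -> q \in R :\: D ->
  exists2 v, v \in R :\: D & attached (component D r) v.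
Proof.
move=> cR DR rD; rewrite inE => /andP[qD qR].
have /connectP[s hs eq] := cR _ _ (subsetP DR _ rD) qR.
suff H b : b \in component D r -> path (inner_edge R) b s -> q = last b s ->
    exists2 v, v \in R :\: D & attached (component D r) v.
  exact: H (component_refl D r) hs eq.
elim: s b {hs eq} => [|a s IH] b bC /=.
  by move=> _ e; have := subsetP (component_sub rD) _ bC; rewrite -e (negPf qD).
move=> /andP[/and3P[ba _ aR] hs] e.
have [aD|aD] := boolP (a \in D); first exact: IH (component_closed rD bC ba aD) hs e.
by exists a; [rewrite inE aD | apply: attachedI bC _; rewrite sedge_sym].
Qed.

Definition bounded_by R (C : pred G) : Prop := forall v, v \notin R -> attached R v -> C v.

Lemma component_bounded R D r (C : pred G) : r \in D -> D \subset R -> bounded_by R C ->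
  bounded_by (component D r) (fun v => C v && (v \notin R) || (v \in R :\: D)).
Proof.
move=> rD DR bR v vC /attachedP[z zC vz].
have vD : v \notin D.
  by apply: contra vC => vD; apply: (component_closed rD zC) => //; rewrite sedge_sym.
apply/orP; have [vR|vR] := boolP (v \in R); [by right; rewrite inE vD|left].
rewrite andbT; apply: bR => //; apply: attachedI vz.
by apply: (subsetP DR); apply: (subsetP (component_sub rD)).
Qed.

(** Only inner vertices must lie in R, so that walks can end on the paths that border it. *)
Definition walk R (n : nat) (a b : G) : Prop := exists f : nat -> G,
  [/\ f 0 = a, f n = b, forall i, i < n -> sedge (f i) (f i.+1) &
      forall i, 0 < i < n -> f i \in R].

Lemma walk0 R a : walk R 0 a a.
Proof. by exists (fun=> a); split=> // i; lia. Qed.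

Lemma walk0E R a b : walk R 0 a b -> a = b.
Proof. by move=> [f [h1 h2 _ _]]; rewrite -h1 -h2. Qed.

Lemma walk_edge R a b : sedge a b -> walk R 1 a b.
Proof.
move=> ab; exists (fun i => if i is 0 then a else b); split=> //; first by case.
by move=> i; lia.
Qed.

Lemma walk_cat R n m a r b : r \in R -> walk R n a r -> walk R m r b -> walk R (n + m) a b.
Proof.
move=> rR [f [f0 fn ff fR]] [g [g0 gm gg gR]].
exists (fun i => if i < n then f i else g (i - n)); split.
- by case: n f0 fn ff fR => [|n] // <- e; rewrite g0 -e.
- by rewrite addKn; case: ltnP => h; [lia | exact: gm].
- move=> i im; case: ltnP => h1; case: ltnP => h2; try lia.
  + exact: ff.
  + have -> : i.+1 - n = 0 by lia.
    by rewrite g0 -fn (_ : n = i.+1); [exact: ff|lia].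
  + by rewrite subSn //; apply: gg; lia.
- move=> i /andP[i0 im]; case: ltnP => h; first by apply: fR; lia.
  have [e|ne] := eqVneq i n; first by rewrite e subnn g0.
  by apply: gR; lia.
Qed.

Lemma walk_sym R n a b : walk R n a b -> walk R n b a.
Proof.
case=> f [f0 fn ff fR]; exists (fun i => f (n - i)); split.
- by rewrite subn0.
- by rewrite subnn.
- by move=> i im; rewrite sedge_sym (_ : n - i = (n - i.+1).+1); [apply: ff|]; lia.
- by move=> i h; apply: fR; lia.
Qed.

Lemma walkW R R' n a b : R \subset R' -> walk R n a b -> walk R' n a b.
Proof. by move=> /subsetP s [f [? ? ? fR]]; exists f; split=> // i /fR /s. Qed.

Lemma walk_piece R (f : nat -> G) i j : i <= j ->
  (forall k, i <= k < j -> sedge (f k) (f k.+1)) -> (forall k, i < k < j -> f k \in R) ->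
  walk R (j - i) (f i) (f j).
Proof.
move=> ij ff fR; exists (fun k => f (i + k)); split; rewrite ?addn0 ?subnKC //.
  by move=> k kj; rewrite addnS; apply: ff; lia.
by move=> k h; apply: fR; lia.
Qed.

Lemma walk_step R n r x b : x \in R -> step r x -> walk R n x b ->
  exists2 m, m <= n.+1 & walk R m r b.
Proof.
move=> xR /orP[/eqP-> h|rx h]; first by exists n; rewrite 1?leqW.
by exists n.+1 => //; apply: (walk_cat xR (walk_edge _ rx) h).
Qed.

End Territory.

(** * Guarding a path *)

Section Guarding.
Variable G : sgraph.
Implicit Types (R : {set G}) (P : nat -> G) (D : pred nat) (r x y : G).

(* For a robber on r, a cop on P p intercepts him at every P i he can reach   *)
(* through R when p lies in all intervals [i - n, i + n], n the length of a   *)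
(* walk from r to P i. A slack of 1 asks it of p and of p + 1.                *)
Definition tracks (w : nat) D P R (p : nat) r : Prop :=
  forall i n, D i -> walk R n r (P i) -> i <= p + n /\ p + w <= i + n.

Definition geodesic (w : nat) D P R : Prop := forall r i j n m, r \in R -> D i -> D j ->
  walk R n r (P i) -> walk R m r (P j) -> i + w <= j + n + m.

Lemma tracksW w D D' P R R' p r : R' \subset R -> (forall i, D' i -> D i) ->
  tracks w D P R p r -> tracks w D' P R' p r.
Proof. by move=> s d h i n /d Di /(walkW s); apply: h. Qed.

Lemma geodesicW w D D' P R R' : R' \subset R -> (forall i, D' i -> D i) ->
  geodesic w D P R -> geodesic w D' P R'.
Proof.
move=> s d h r i j n m /(subsetP s) rR /d Di /d Dj /(walkW s) hi /(walkW s) hj.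
exact: h hi hj.
Qed.

(* Helly's theorem on the line.                                               *)
Lemma tracks_step w D P R p r x L : w <= 1 -> geodesic w D P R -> (forall i, D i -> i <= L) ->
  tracks w D P R p r -> p <= L -> x \in R -> step r x ->
  exists p', [/\ tracks w D P R p' x, p' <= L, p' <= p.+1 & p <= p'.+1].
Proof.
move=> w1 geo DL tr pL xR rx.
have near i n : D i -> walk R n x (P i) -> i <= p + n.+1 /\ p + w <= i + n.+1.
  by move=> Di /(walk_step xR rx)[m mn hm]; have := tr i m Di hm; lia.
have [[i [n [Di hi c]]]|no] := pselect (exists i n, [/\ D i, walk R n x (P i) & p + n < i]).
  exists p.+1; split=> //; last by lia.
    move=> j m Dj hj; have := near j m Dj hj; have := geo x i j n m xR Di Dj hi hj; lia.
  by have := DL i Di; lia.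
have [[i [n [Di hi c]]]|no'] := pselect (exists i n, [/\ D i, walk R n x (P i) & i + n < p + w]).
  have := geo x i i n n xR Di Di hi hi => self.
  exists p.-1; split; try lia.
  move=> j m Dj hj; have := near j m Dj hj; have := geo x j i m n xR Dj Di hj hi; lia.
exists p; split=> //; try lia.
move=> i n Di hi; split; rewrite leqNgt; apply/negP => c.
  by apply: no; exists i, n.
by apply: no'; exists i, n.
Qed.

(** Take the least p beyond all left ends i - n. It is 0 or is itself a left end, and [geodesic]
    compares that one with every right end. *)
Lemma tracks_ex w D P R r L : w <= 1 -> geodesic w D P R -> (forall i, D i -> i <= L) -> r \in R ->
  exists2 p, tracks w D P R p r & p <= L.
Proof.
move=> w1 geo DL rR.
have ex : exists p, `[< forall i n, D i -> walk R n r (P i) -> i <= p + n >].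
  by exists L; apply/asboolP => i n /DL; lia.
case: (ex_minnP ex) => p /asboolP hp pmin; exists p; last first.
  by apply: pmin; apply/asboolP => i n /DL; lia.
move=> i n Di hi; split; first exact: hp hi.
case: p hp pmin => [|p] hp pmin; first by have := geo r i i n n rR Di Di hi hi; lia.
have [[j [m [Dj hj c]]]|no] := pselect (exists j m, [/\ D j, walk R m r (P j) & p + m < j]).
  by have := geo r j i m n rR Dj Di hj hi; lia.
suff : p.+1 <= p by rewrite ltnn.
apply: pmin; apply/asboolP => j m Dj hj; rewrite leqNgt; apply/negP => c.
by apply: no; exists j, m.
Qed.

Definition route P (L : nat) : Prop := forall i, i < L -> sedge (P i) (P i.+1).

(** The index p + 1 may exceed L, so the path is frozen at its end. *)
Definition stop P L (i : nat) : G := P (minn i L).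
Definition trio P L p := [:: stop P L p.-1; stop P L p; stop P L p.+1].
Definition duo P L p := [:: stop P L p; stop P L p.+1].

Lemma step_stop P L i j : route P L -> i <= j.+1 -> j <= i.+1 -> step (stop P L i) (stop P L j).
Proof.
move=> hP ij ji; rewrite /stop /step.
have [->|[[e1 e2]|[e1 e2]]] : minn i L = minn j L \/
   (minn j L = (minn i L).+1 /\ minn i L < L) \/ (minn i L = (minn j L).+1 /\ minn j L < L) by lia.
- by rewrite eqxx.
- by rewrite e1 hP ?orbT.
- by rewrite e1 sedge_sym hP ?orbT.
Qed.

Lemma mem_stop P L i j : i <= L -> j = i -> P i = stop P L j.
Proof. by move=> iL ->; rewrite /stop (minn_idPl iL). Qed.

Lemma trio_blocks P L p j : j <= L -> j <= p.+1 -> p <= j.+1 -> P j \in trio P L p.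
Proof.
move=> jL h1 h2; rewrite !inE.
have [e|[e|e]] : p.-1 = j \/ p = j \/ p.+1 = j by lia.
all: by rewrite -(mem_stop P jL e) eqxx ?orbT.
Qed.

Lemma duo_blocks P L p j : j <= L -> j <= p.+1 -> p <= j -> P j \in duo P L p.
Proof.
move=> jL h1 h2; rewrite !inE.
have [e|e] : p = j \/ p.+1 = j by lia.
all: by rewrite -(mem_stop P jL e) eqxx ?orbT.
Qed.

Lemma tracks_adjacent w D P R p r j : tracks w D P R p r -> D j -> sedge r (P j) ->
  j <= p.+1 /\ p + w <= j.+1.
Proof. by move=> h Dj /(walk_edge R)/(h _ _ Dj); rewrite !addn1. Qed.

Lemma trio_step P L p p' : route P L -> p <= p'.+1 -> p' <= p.+1 ->
  all2 (@step G) (trio P L p) (trio P L p').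
Proof. by move=> hP h1 h2; rewrite /= !step_stop //; lia. Qed.

Lemma duo_step P L p p' : route P L -> p <= p'.+1 -> p' <= p.+1 ->
  all2 (@step G) (duo P L p) (duo P L p').
Proof. by move=> hP h1 h2; rewrite /= !step_stop //; lia. Qed.

(** The invariant I is left arbitrary, so that the guards of one side keep their method while the
    rest of the team is reorganised. *)
Definition guard R (X : pred G) (I : seq G -> G -> Prop) : Prop := forall s r, I s r -> r \in R ->
  (forall y, X y -> sedge r y -> y \in s) /\
  (forall x, x \in R -> step r x -> exists2 s', all2 (@step G) s s' & I s' x).

Lemma guardW R R' (X X' : pred G) I : R' \subset R ->
  (forall y, X' y -> attached R' y -> X y) -> guard R X I -> guard R' X' I.
Proof.
move=> /subsetP s d h c r /h{}h rR'; have [h1 h2] := h (s r rR'); split.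
  by move=> y X'y ry; apply: h1 => //; apply: d => //; apply: attachedI rR' _; rewrite sedge_sym.
by move=> x /s xR; apply: h2.
Qed.

Definition duo_guard D P L R : seq G -> G -> Prop :=
  fun s r => exists q, [/\ s = duo P L q, tracks 1 D P R q r & q <= L].

Lemma duo_guardP D P L R : route P L -> (forall i, D i -> i <= L) -> geodesic 1 D P R ->
  guard R (fun y => [exists i : 'I_L.+1, D i && (y == P i)]) (duo_guard D P L R).
Proof.
move=> hP DL geo s r [q [-> tr qL]] rR; split.
  move=> y /existsP[i /andP[Di /eqP->]] ry.
  by have := tracks_adjacent tr Di ry => -[h1 h2]; apply: duo_blocks; have := DL _ Di; lia.
move=> x xR rx; have [q' [tr' q'L h1 h2]] := tracks_step (leqnn 1) geo DL tr qL xR rx.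
by exists (duo P L q'); [exact: duo_step | exists q'].
Qed.

(** If p fails the slack, some right end i + n equals p; by tightness all left ends are then below
    p, and p - 1 works. This is what releases one of the three cops on a tight path. *)
Lemma tracks_tighten D P R p r : geodesic 1 D P R -> r \in R -> tracks 0 D P R p r ->
  tracks 1 D P R p r \/ exists2 q, p = q.+1 & tracks 1 D P R q r.
Proof.
move=> geo rR tr; have [h|h] := pselect (tracks 1 D P R p r); [by left|right].
have [i [n [Di hi c]]] : exists i n, [/\ D i, walk R n r (P i) & i + n < p + 1].
  have [//|no] := pselect (exists i n, [/\ D i, walk R n r (P i) & i + n < p + 1]).
  case: h => i n Di hi; have := tr i n Di hi; rewrite addn0 => -[h1 h2]; split=> //.
  by rewrite leqNgt; apply/negP => c; apply: no; exists i, n.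
have := geo r i i n n rR Di Di hi hi; have := tr i n Di hi.
case: p tr h c => [|q] tr h c h1 h2; first by lia.
exists q => // j m Dj hj; have := geo r j i m n rR Dj Di hj hi; have := tr j m Dj hj; lia.
Qed.

Section Catch.
Hypothesis connG : connected_graph G.

Lemma gather (f g : seq G) : size f = size g -> exists (N : nat) (F : nat -> seq G),
  [/\ F 0 = f, forall i, N <= i -> F i = g & forall i, all2 (@step G) (F i) (F i.+1)].
Proof.
elim: f g => [|x f IH] [|y g] //=; first by exists 0, (fun=> [::]).
case=> /IH[N [F [F0 FN FF]]]; have /connectP[s hs ey] := connG x y.
exists (maxn N (size s)), (fun i => last x (take i s) :: F i); split.
- by rewrite take0 F0.
- by move=> i; rewrite geq_max => /andP[/FN -> si]; rewrite take_oversize // ey.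
move=> i; rewrite /= FF andbT {ey}; elim: s x i hs => [|a s IHs] x [|i] //= => [_|_|/andP[xa _]|].
- exact: stepxx.
- exact: stepxx.
- by rewrite take0 /step xa orbT.
- by case/andP => _; apply: IHs.
Qed.

(* The cops s keep an invariant J with parameter t while k further cops walk  *)
(* to B 0 and then along B until they stand on B t.                           *)
Lemma catch (J : seq G -> nat -> G -> Prop) (B : nat -> seq G) (L k : nat) :
  (forall i, size (B i) = k) -> (forall i, all2 (@step G) (B i) (B i.+1)) ->
  (forall s t r, J s t r -> t <= L /\ forall x, step r x -> x \notin s ->
    exists2 s', all2 (@step G) s s' &
      (forall f, size f = k -> robber_loses (s' ++ f) x) \/
      (exists2 t', t <= t'.+1 & J s' t' x)) ->
  (forall s t r, J s t r -> robber_loses (s ++ B t) r) ->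
  forall s t r f, J s t r -> size f = k -> robber_loses (s ++ f) r.
Proof.
move=> szB stB hJ hend.
(* As t drops by at most one per round, the cops on [B i] with i <= t cannot be passed: they meet t
   or advance, and t never exceeds L. *)
have along d i s t r : L - i <= d -> i <= t -> J s t r -> robber_loses (s ++ B i) r.
  elim: d i s t r => [|d IH] i s t r Lid it Jst; have [tL hst] := hJ s t r Jst.
    by rewrite (_ : i = t); [exact: hend | lia].
  have [->|ne] := eqVneq i t; first exact: hend.
  apply: robber_losesI => x rx; rewrite mem_cat negb_or => /andP[xs _].
  have [s' ss' [out|[t' tt' J']]] := hst x rx xs.
    by exists (s' ++ B i); [apply: all2_cat (all2_stepxx _) | apply: out].
  have [e|ne'] := eqVneq i t'.
    by exists (s' ++ B i); [apply: all2_cat (all2_stepxx _) | rewrite e; apply: hend].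
  by exists (s' ++ B i.+1); [apply: all2_cat | apply: IH J'; lia].
move=> s t r f Jst szf; have [N [F [<- FN FF]]] : exists (N : nat) (F : nat -> seq G),
  [/\ F 0 = f, forall i, N <= i -> F i = B 0 & forall i, all2 (@step G) (F i) (F i.+1)].
  by apply: gather; rewrite szB.
suff H d i s' t' r' : N - i <= d -> J s' t' r' -> robber_loses (s' ++ F i) r' by exact: H Jst.
elim: d i s' t' r' => [|d IH] i s' t' r' Nid J'.
  by rewrite FN; [apply: along J' | lia].
have [_ hst] := hJ _ _ _ J'.
apply: robber_losesI => x rx; rewrite mem_cat negb_or => /andP[xs _].
have szF j : size (F j) = k.
  by rewrite -(szB 0) -(FN (j + N)) ?leq_addl //; elim: (N) => [|M ->]; rewrite ?addn0 // addnS (all2_step_size (FF _)).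
have [s'' ss [out|[t'' tt J'']]] := hst x rx xs.
  by exists (s'' ++ F i); [apply: all2_cat (all2_stepxx _) | apply: out].
by exists (s'' ++ F i.+1); [apply: all2_cat | apply: IH J''; lia].
Qed.

End Catch.
End Guarding.

(** * Enclosing cycles and their chords *)

Ltac permute := let a := fresh in apply/permP => a; do 4!rewrite ?count_cat /=; clear; lia.

Section Rings.
Variable G : sgraph.
Implicit Types (R : {set G}) (P : nat -> G) (r x y : G).

Definition arc P i n : seq G := [seq P k | k <- iota i n].

Lemma mem_arc P i n v : reflect (exists2 k, i <= k < i + n & v = P k) (v \in arc P i n).
Proof.
apply: (iffP mapP) => -[k kin ->]; exists k => //; first by rewrite mem_iota in kin.
by rewrite mem_iota.
Qed.

Lemma arc_cat P i n m : arc P i (n + m) = arc P i n ++ arc P (i + n) m.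
Proof. by rewrite /arc iotaD map_cat. Qed.

Lemma path_arc P L i n : route P L -> i + n <= L -> path sedge (P i) (arc P i.+1 n).
Proof.
move=> hP; elim: n i => //= n IH i h; rewrite hP ?IH //; by lia.
Qed.

Lemma uniq_arc P i n : (forall j k, i <= j < i + n -> i <= k < i + n -> P j = P k -> j = k) ->
  uniq (arc P i n).
Proof.
move=> inj; rewrite map_inj_in_uniq ?iota_uniq // => j k.
by rewrite !mem_iota => hj hk; apply: inj.
Qed.

Lemma eq_arc P Q i n : (forall k, i <= k < i + n -> P k = Q k) -> arc P i n = arc Q i n.
Proof. by move=> h; apply/eq_in_map => k; rewrite mem_iota; apply: h. Qed.

Lemma path_rev x y (C : seq G) : path sedge y (rcons C x) -> path sedge x (rcons (rev C) y).
Proof.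
move=> h; have := rev_path sedge y (rcons C x).
rewrite last_rcons belast_rcons rev_cons => ->.
by apply: sub_path h => a b; rewrite /= sedge_sym.
Qed.

Lemma cycle_halves x y (C1 C2 : seq G) : cycle sedge (x :: C1 ++ y :: C2) =
  path sedge x (rcons C1 y) && path sedge y (rcons C2 x).
Proof. by rewrite /= rcons_cat rcons_cons -cat_rcons cat_path last_rcons. Qed.

Lemma connected_in_walk R u v : connected_in R -> u \in R -> v \in R -> exists n, walk R n u v.
Proof.
move=> cR uR vR; have /connectP[s hs ->] := cR u v uR vR.
elim: s u uR hs => [|a s IH] u uR /=; first by exists 0; exact: walk0.
case/andP => /and3P[ua _ aR] /(IH a aR)[n hn]; exists (1 + n).
exact: walk_cat aR (walk_edge _ ua) hn.
Qed.

(** P is a shortest walk from x to y that visits R, so a direct edge xy does not compete. A shortcut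
    through R between two of its vertices would shorten it. *)
Lemma shortest_through R x y : connected_in R -> x \notin R -> y \notin R ->
  attached R x -> attached R y ->
  exists P L, [/\ route P L, P 0 = x, P L = y, 1 < L & forall i, 0 < i < L -> P i \in R] /\
    geodesic 0 (fun i => i <= L) P R.
Proof.
move=> cR xR yR /attachedP[z zR xz] /attachedP[z' z'R yz'].
pose through l := exists r n m, [/\ r \in R, walk R n r x, walk R m r y & l = n + m].
have ex : exists l, `[< through l >].
  have [n hn] := connected_in_walk cR zR z'R.
  exists (1 + (n + 1)); apply/asboolP; exists z, 1, (n + 1); split=> //.
    by apply: walk_edge; rewrite sedge_sym.
  by apply: walk_cat z'R hn (walk_edge _ _); rewrite sedge_sym.
case: (ex_minnP ex) => L /asboolP[r [n [m [rR hx hy eL]]]] Lmin.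
have [P [P0 PL PP PR]] := walk_cat rR (walk_sym hx) hy.
have n0 : 0 < n by case: n hx {eL PL PP PR} => // /walk0E e; rewrite -e rR in xR.
have m0 : 0 < m by case: m hy {eL PL PP PR} => // /walk0E e; rewrite -e rR in yR.
exists P, L; rewrite eL; split; first by split=> //; lia.
move=> r' i j n' m' r'R iL jL hi hj; have [//|ji] : i <= j \/ j < i by lia.
  by lia.
have hx' : walk R (m' + j) r' x.
  case: j jL hj ji => [|j] jL hj ji; first by rewrite addn0 -P0.
  apply: walk_cat (PR _ _) hj _; first by lia.
  rewrite -P0 -[X in walk _ X]subn0; apply/walk_sym/walk_piece => // k hk; [apply: PP|apply: PR]; lia.
have hy' : walk R (n' + (n + m - i)) r' y.
  have [e|ne] := eqVneq i (n + m); first by rewrite e subnn addn0 -PL -e.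
  apply: walk_cat (PR _ _) hi _; first by lia.
  rewrite -PL; apply: walk_piece => // k hk; [apply: PP|apply: PR]; lia.
have : L <= m' + j + (n' + (n + m - i)).
  by apply: Lmin; apply/asboolP; exists r', (m' + j), (n' + (n + m - i)).
by lia.
Qed.

(** The one consequence of planarity on which the strategy relies. *)
Definition theta_free : Prop := forall x y (A1 A2 A3 : seq G) R,
  path sedge x (rcons A1 y) -> path sedge x (rcons A2 y) -> path sedge x (rcons A3 y) ->
  uniq (x :: y :: A1 ++ A2 ++ A3) -> connected_in R ->
  (forall v, v \in x :: y :: A1 ++ A2 ++ A3 -> v \notin R) ->
  has (attached R) A1 -> has (attached R) A2 -> has (attached R) A3 -> False.

Lemma lattice_drawing_theta_free node line : @lattice_drawing G node line -> theta_free.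
Proof.
move=> drawn x y A1 A2 A3 R p1 p2 p3 /=; rewrite !inE !cat_uniq !mem_cat !negb_or.
case/and4P=> [/and4P[xy x1 x2 x3] /and3P[y1 y2 y3] u1 /and4P[]].
rewrite has_cat negb_or => /andP[d12 d13] u2 d23 u3 cR dis a1 a2 a3.
pose A (i : 'I_3) := nth [::] [:: A1; A2; A3] i.
have cover (Q : seq G -> Prop) : Q A1 -> Q A2 -> Q A3 -> forall i, Q (A i).
  by move=> q1 q2 q3 [[|[|[|//]]] ?].
apply: (no_attached_theta drawn xy (A := A) (R := R)) => //.
- exact: (cover (fun C => [/\ path sedge x (rcons C y), x \notin C & y \notin C])).
- have hs (B C : seq G) : ~~ has [in B] C -> ~~ has [in C] B.
    by move=> /hasPn h; apply/hasPn => v vB; apply/negP => vC; move: (h v vC); rewrite /= vB.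
  by move=> [[|[|[|//]]] ?] [[|[|[|//]]] ?] //= _; rewrite /A /= // hs.
- by apply: dis; rewrite mem_head.
- by apply: dis; rewrite !inE eqxx orbT.
- move=> i a; apply: (cover (fun C => a \in C -> a \notin R)) => ha;
    by apply: dis; rewrite !inE !mem_cat ha !orbT.
- apply: (cover (fun C => exists a z, [/\ a \in C, z \in R & sedge a z])).
  + by case/hasP: a1 => a aA /attachedP[z zR az]; exists a, z.
  + by case/hasP: a2 => a aA /attachedP[z zR az]; exists a, z.
  + by case/hasP: a3 => a aA /attachedP[z zR az]; exists a, z.
Qed.

(** A cycle of two adjacent vertices is allowed; it occurs in [wins_vertex_step]. *)
Record enclosed R (K : seq G) : Prop := Enclosed {
  enclosed_cycle : cycle sedge K;
  enclosed_uniq : uniq K;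
  enclosed_disjoint : forall v, v \in K -> v \notin R;
  enclosed_bounded : bounded_by R (fun v => v \in K);
  enclosed_connected : connected_in R }.

Lemma enclosed_catC R (K K' : seq G) : enclosed R (K ++ K') -> enclosed R (K' ++ K).
Proof.
case=> h1 h2 h3 h4 h5; split=> //.
- by rewrite -rot_size_cat rot_cycle.
- by rewrite uniq_catC.
- by move=> v hv; apply: h3; move: hv; rewrite !mem_cat orbC.
- by move=> v vR /(h4 v vR); rewrite !mem_cat orbC.
Qed.

Section Chord.
Hypothesis no_theta : theta_free.
Variables (R : {set G}) (x y : G) (C1 C2 : seq G) (P : nat -> G) (L : nat) (r : G).
Hypothesis encR : enclosed R (x :: C1 ++ y :: C2).
Hypotheses (routeP : route P L) (P0 : P 0 = x) (PL : P L = y) (L1 : 1 < L).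
Hypothesis inR : forall i, 0 < i < L -> P i \in R.
Hypothesis geoP : geodesic 0 (fun i => i <= L) P R.

Definition off_chord : {set G} := R :\: [set v in arc P 1 L.-1].

Lemma chord_inj i j : i <= L -> j <= L -> P i = P j -> i = j.
Proof.
have Kx : x \notin R by apply: (enclosed_disjoint encR); rewrite mem_head.
have Ky : y \notin R by apply: (enclosed_disjoint encR); rewrite !inE mem_cat mem_head !orbT.
have xy : x != y.
  by have := enclosed_uniq encR; rewrite /= mem_cat inE; case: eqP; rewrite ?orbT.
wlog ij : i j / i < j => [W iL jL e|].
  by have [h|h|//] := ltngtP i j; [apply: W|symmetry; apply: W].
move=> iL jL e; exfalso.
have [i0|i0] := eqVneq i 0.
  move: e; rewrite i0 P0 => e; have [jeq|jne] := eqVneq j L.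
    by move: e xy; rewrite jeq PL => ->; rewrite eqxx.
  by move: Kx; rewrite e inR //; lia.
have iR : P i \in R by apply: inR; lia.
have := geoP iR jL iL _ (walk0 R (P i)) => /(_ 0); rewrite -e => /(_ (walk0 R (P i))); lia.
Qed.

Hypothesis rD : r \in off_chord.
Let R' := component off_chord r.

Lemma off_chord_sub : off_chord \subset R.
Proof. exact: subsetDl. Qed.

Lemma chord_component_sub : R' \subset R.
Proof. exact: subset_trans (component_sub rD) off_chord_sub. Qed.

Lemma chord_component_card : #|R'| < #|R|.
Proof.
apply/proper_card/properP; split; first exact: chord_component_sub.
exists (P 1); first by apply: inR; lia.
apply/negP => /(subsetP (component_sub rD)); rewrite inE inE => /andP[/negP[]].
by apply/mem_arc; exists 1 => //; lia.
Qed.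

Lemma chord_notin v : v \in arc P 0 L.+1 -> v \notin R'.
Proof.
case/mem_arc => k hk ->; apply/negP => h.
have [[k0 kL]|[e|e]] : (0 < k /\ k < L) \/ k = 0 \/ k = L by lia.
- have := subsetP (component_sub rD) _ h; rewrite inE inE => /andP[/negP no _].
  by apply: no; apply/mem_arc; exists k => //; lia.
- have := subsetP chord_component_sub _ h; apply/negP; apply: (enclosed_disjoint encR).
  by rewrite e P0 mem_head.
- have := subsetP chord_component_sub _ h; apply/negP; apply: (enclosed_disjoint encR).
  by rewrite e PL !inE mem_cat mem_head !orbT.
Qed.

Lemma chord_attached : has (attached R') (arc P 1 L.-1).
Proof.
have P1 : P 1 \in R :\: off_chord.
  rewrite inE [P 1 \in R]inR ?andbT; last by lia.
  rewrite inE inE negb_and negbK; apply/orP; left.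
  by apply/mem_arc; exists 1 => //; lia.
have [v] := component_attached (enclosed_connected encR) off_chord_sub rD P1.
rewrite inE [v \in off_chord]inE inE negb_and negbK => /andP[/orP[h _ av|/negP h hR //]].
by apply/hasP; exists v.
Qed.

Lemma arc_chord : arc P 0 L.+1 = x :: rcons (arc P 1 L.-1) y.
Proof.
have -> : L.+1 = 1 + (L.-1 + 1) by lia.
rewrite !arc_cat /= P0 cats1 add0n; congr (_ :: rcons _ _).
by rewrite -PL; congr (P _); lia.
Qed.

Lemma chord_bounded v : v \notin R' -> attached R' v ->
  (v \in x :: C1 ++ y :: C2) || (v \in arc P 1 L.-1).
Proof.
move=> vR' av; have := component_bounded rD off_chord_sub (enclosed_bounded encR) vR' av.
case/orP => [/andP[-> _] //|]; rewrite inE [v \in off_chord]inE inE negb_and negbK.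
by case/andP => /orP[->|/negP//]; rewrite orbT.
Qed.

(** C1, C2 and the chord are the three sides of a theta graph. As R was connected, the component is
    attached to the chord, hence to at most one of C1 and C2, and the other leaves the enclosing
    cycle. *)
Lemma chord_split :
  if has (attached R') C1
  then ~~ has (attached R') C2 /\ enclosed R' (arc P 0 L.+1 ++ rev C1)
  else enclosed R' (arc P 0 L.+1 ++ C2).
Proof.
have [cyc uniqK dis _ conn] := encR.
have /andP[p1 p2] : path sedge x (rcons C1 y) && path sedge y (rcons C2 x) by rewrite -cycle_halves.
have p3 : path sedge x (rcons (arc P 1 L.-1) y).
  have := path_arc routeP (leqnn L : 0 + L <= L); rewrite P0.
  have -> : arc P 1 L = rcons (arc P 1 L.-1) y; last by [].
  by have := arc_chord; rewrite /arc /= => -[_ ->].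
have sepR v : v \in x :: C1 ++ y :: C2 -> v \notin arc P 1 L.-1.
  move=> /dis vR; apply/negP => /mem_arc[k hk e]; move: vR; rewrite e inR //; lia.
have uA : uniq (arc P 1 L.-1).
  by apply: uniq_arc => j k hj hk; apply: chord_inj; lia.
have uAll : uniq (x :: y :: C1 ++ C2 ++ arc P 1 L.-1).
  have : uniq ((x :: C1 ++ y :: C2) ++ arc P 1 L.-1).
    by rewrite cat_uniq uniqK uA andbT; apply/hasPn => v vA; apply/negP => /sepR; rewrite vA.
  by apply: etrans; apply: perm_uniq; permute.
have disR' v : v \in x :: C1 ++ y :: C2 -> v \notin R'.
  by move=> /dis; apply: contra; apply: (subsetP chord_component_sub).
have enclosed_side C : {subset C <= C1 ++ C2} -> path sedge y (rcons C x) -> uniq C ->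
    (forall v, v \in C1 ++ C2 -> attached R' v -> v \in C) -> enclosed R' (arc P 0 L.+1 ++ C).
  move=> sC pC uC bC; rewrite arc_chord -cats1 cat_cons -catA; split.
  - by rewrite cycle_halves p3.
  - have sub v : v \in C -> v \notin [:: x, y & arc P 1 L.-1].
      move=> /sC; rewrite mem_cat => vC; apply/negP.
      move: uAll; rewrite catA /= inE cat_uniq => /and3P[/norP[_ x1] y1 /and3P[_ /hasPn d _]].
      rewrite !inE => /or3P[/eqP e|/eqP e|h].
      + by move: x1; rewrite mem_cat -e mem_cat vC.
      + by move: y1; rewrite mem_cat -e mem_cat vC.
      + by move: (d v h); rewrite /= mem_cat vC.
    have : uniq ((x :: y :: arc P 1 L.-1) ++ C).
      rewrite cat_uniq uC andbT; apply/andP; split; last by apply/hasPn.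
      move: uAll; rewrite /= !inE !mem_cat !negb_or => /and3P[/and4P[-> _ _ ->] /and3P[_ _ ->] _].
      exact: uA.
    by apply: etrans; apply: perm_uniq; permute.
  - move=> v; rewrite -cat_rcons -cat_cons -arc_chord mem_cat => /orP[/chord_notin//|/sC h].
    by apply: disR'; move: h; rewrite !inE !mem_cat inE => /orP[] ->; rewrite !orbT.
  - move=> v vR' av; rewrite !(inE, mem_cat).
    have := chord_bounded vR' av; rewrite !(inE, mem_cat).
    have := bC v; rewrite mem_cat => /(_ _ av).
    by case: (v == x) (v == y) (v \in C1) (v \in C2) (v \in arc _ _ _) => [] [] [] [] [] //= -> //;
      rewrite !orbT.
  - exact: component_connected.
have [u1 u2] : uniq C1 /\ uniq C2.
  by move: uniqK; rewrite /= cat_uniq /= => /and5P[_ ? _ _ ?].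
have [h1|h1] := boolP (has (attached R') C1); last first.
  apply: enclosed_side => //; first by move=> v; rewrite mem_cat orbC => ->.
  move=> v; rewrite mem_cat => /orP[vC av|//].
  by case/negP: h1; apply/hasP; exists v.
have [h2|h2] := boolP (has (attached R') C2); last first.
  split=> //; apply: enclosed_side.
  - by move=> v; rewrite mem_rev mem_cat => ->.
  - exact: path_rev p1.
  - by rewrite rev_uniq.
  move=> v; rewrite mem_cat mem_rev => /orP[//|vC av].
  by case/negP: h2; apply/hasP; exists v.
exfalso; apply: (no_theta p1 (path_rev p2) p3 (R := R')) => //.
- by move: uAll; apply: etrans; apply/perm_uniq/permP => p; rewrite /= !count_cat count_rev.
- exact: component_connected.
- move=> v hv; rewrite !(inE, mem_cat) mem_rev in hv.
  have [h|h] := boolP (v \in arc P 1 L.-1).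
    by apply: chord_notin; rewrite arc_chord inE mem_rcons inE h !orbT.
  apply: disR'; rewrite !(inE, mem_cat); move: hv; rewrite (negPf h) orbF.
  by case/or4P => ->; rewrite ?orbT.
- by rewrite has_rev.
- exact: chord_attached.
Qed.

End Chord.
End Rings.

(** * Taking a new path *)

Section Strategy.
Variable G : sgraph.
Hypotheses (connG : connected_graph G) (no_theta : theta_free G).
Implicit Types (R : {set G}) (P : nat -> G) (r x y : G) (s f : seq G).

Lemma guard_stays R (X : pred G) I s r x : guard R X I -> bounded_by R X -> I s r -> r \in R ->
  step r x -> x \notin s -> x \in R.
Proof.
move=> gX bX Is rR /orP[/eqP<-//|rx] xs; apply/negPn/negP => xR.
have [h _] := gX s r Is rR; case/negP: xs; apply: h => //.
by apply: bX => //; apply: attachedI rR _; rewrite sedge_sym.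
Qed.

Lemma tracks_meets (D : pred nat) P R p r i : tracks 0 D P R p r -> D i -> step r (P i) ->
  i <= p.+1 /\ p <= i.+1.
Proof.
move=> tr Di /orP[/eqP e|h].
  by have := tr i 0 Di; rewrite -e => /(_ (walk0 R r)); lia.
by have := tracks_adjacent tr Di h; rewrite addn0.
Qed.

(** Three idle cops walk to P and catch up with the moving index p. One round later the robber is
    off P, since every vertex of P within his reach was occupied. *)
Lemma take_path R (X : pred G) I P L : guard R X I -> bounded_by R X -> route P L ->
  geodesic 0 (fun i => i <= L) P R ->
  (forall s p r, I s r -> tracks 0 (fun i => i <= L) P R p r -> p <= L -> r \in R ->
     (forall i, i <= L -> r != P i) -> robber_loses (s ++ trio P L p) r) ->
  forall s r f, I s r -> r \in R -> size f = 3 -> robber_loses (s ++ f) r.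
Proof.
move=> gX bX hP geo hend s r f Is rR f3.
have [p tr pL] := tracks_ex (leq0n 1) geo (fun i iL => iL) rR.
have respond s' r' p' x : I s' r' -> r' \in R -> tracks 0 (fun i => i <= L) P R p' r' -> p' <= L ->
    step r' x -> x \notin s' -> x \in R /\ exists s'' p'', [/\ all2 (@step G) s' s'', I s'' x,
     tracks 0 (fun i => i <= L) P R p'' x & [/\ p'' <= L, p'' <= p'.+1 & p' <= p''.+1]].
  move=> Is' r'R tr' p'L r'x xs'; have xR := guard_stays gX bX Is' r'R r'x xs'.
  have [_ /(_ x xR r'x)[s'' st Is'']] := gX s' r' Is' r'R.
  have [p'' [h1 h2 h3 h4]] := tracks_step (leq0n 1) geo (fun i iL => iL) tr' p'L xR r'x.
  by split=> //; exists s'', p''.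
apply: (@catch _ connG (fun s t r => [/\ I s r, r \in R, tracks 0 (fun i => i <= L) P R t r & t <= L])
  (trio P L) L 3 _ _ _ _ s p r f) => //.
- by move=> i; apply: trio_step => //; lia.
- move=> s' t r' [Is' r'R tr' tL]; split=> // x r'x xs'.
  have [xR [s'' [t' [h1 h2 h3 [h4 h5 h6]]]]] := respond s' r' t x Is' r'R tr' tL r'x xs'.
  by exists s'' => //; right; exists t'.
move=> s' t r' [Is' r'R tr' tL]; apply: robber_losesI => x r'x.
rewrite mem_cat negb_or => /andP[xs' xt].
have [xR [s'' [t' [h1 h2 h3 [h4 h5 h6]]]]] := respond s' r' t x Is' r'R tr' tL r'x xs'.
exists (s'' ++ trio P L t'); first by apply: all2_cat => //; apply: trio_step.
apply: hend => // i iL; apply: contraNneq xt => e; rewrite e in r'x *.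
by have [h h'] := tracks_meets tr' iL r'x; apply: trio_blocks.
Qed.

(* In these three positions f lists the idle cops.                            *)
Definition wins_vertex R : Prop := forall x f r, x \notin R -> connected_in R ->
  bounded_by R (pred1 x) -> r \in R -> size f = 6 -> robber_loses (x :: f) r.

Definition wins_loose R : Prop := forall P L S I p s f r, route P L ->
  enclosed R (arc P 0 L.+1 ++ S) -> geodesic 0 (fun i => i <= L) P R ->
  guard R (fun v => v \in S) I -> I s r -> size s = 2 ->
  tracks 0 (fun i => i <= L) P R p r -> p <= L -> r \in R -> size f = 2 ->
  robber_loses (s ++ trio P L p ++ f) r.

Definition wins_tight R : Prop := forall A S IA IS sA sS f r, A != [::] -> enclosed R (A ++ S) ->
  guard R (fun v => v \in A) IA -> guard R (fun v => v \in S) IS ->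
  IA sA r -> IS sS r -> size sA = 2 -> size sS = 2 -> r \in R -> size f = 3 ->
  robber_loses (sA ++ sS ++ f) r.

(** A cop goes to a vertex y of R, adjacent to x if x is attached. If the new component touches only
    one of x and y, it is a smaller instance. Otherwise the edge xy is an enclosing cycle of length
    two, and a shortest path from x to y through the component is taken. *)
Lemma wins_vertex_step R : (forall R' : {set G}, #|R'| < #|R| -> wins_vertex R' /\ wins_loose R') -> wins_vertex R.
Proof.
move=> IH x f r xR cR bR rR f6.
have [y yR hy] : exists2 y, y \in R & attached R x -> sedge x y.
  have [/attachedP[y yR xy]|_] := boolP (attached R x); last by exists r.
  by exists y.
case: f f6 => [//|z0 f] [f5]; rewrite -/([:: x] ++ z0 :: f).
have stays r' x' t : r' \in R -> step r' x' -> x' \notin x :: t -> x' \in R.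
  move=> r'R /orP[/eqP<-//|rx]; rewrite inE negb_or => /andP[nx _].
  by apply/negPn/negP => /bR /=; rewrite (negPf nx) => /(_ (attachedI r'R _)); rewrite sedge_sym => /(_ rx).
apply: (robber_loses_perm (c := (x :: f) ++ [:: z0])).
  by rewrite /= perm_cons -cat1s perm_catC.
apply: (@catch _ connG (fun s t r => [/\ s = x :: f, t = 0 & r \in R])
  (fun=> [:: y]) 0 1 _ _ _ _ (x :: f) 0 r [:: z0]) => //.
- by move=> _; apply: all2_stepxx.
- move=> s t r' [-> -> r'R]; split=> // x' rx' xs; exists (x :: f); first exact: all2_stepxx.
  by right; exists 0 => //; split=> //; apply: stays rx' xs.
move=> s t r' [-> _ r'R]; apply: robber_losesI => x' rx'; rewrite mem_cat negb_or => /andP[xs].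
rewrite inE => x'y; exists ((x :: f) ++ [:: y]); first exact: all2_stepxx.
have x'R : x' \in R by apply: stays rx' xs.
set D := R :\ y; have DR : D \subset R by apply: subsetDl.
have x'D : x' \in D by rewrite !inE x'y.
set R' := component D x'; have cR' : connected_in R' := @component_connected _ _ _.
have yR' : y \notin R' by apply/negP => /(subsetP (component_sub x'D)); rewrite !inE eqxx.
have xR' : x \notin R'.
  by apply: contra xR => /(subsetP (component_sub x'D)); apply: (subsetP DR).
have small : #|R'| < #|R|.
  apply/proper_card/properP; split; last by exists y.
  exact: subset_trans (component_sub x'D) DR.
have bR' v : v \notin R' -> attached R' v -> (v == x) || (v == y).
  move=> vR' /(component_bounded x'D DR bR vR') /orP[/andP[/= -> //]|].
  by rewrite !inE negb_and !negbK andb_orl => /orP[/andP[->]|/andP[/negPf->//]]; rewrite orbT.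
have [W1 WX] := IH R' small.
have x'R' : x' \in R' := component_refl D x'.
have perm_y : perm_eq (y :: x :: f) ((x :: f) ++ [:: y]) by rewrite cats1 perm_sym perm_rcons.
have [ax|ax] := boolP (attached R' x); last first.
  apply: robber_loses_perm perm_y _; apply: W1 => //=; last by rewrite f5.
  by move=> v vR' av; have /orP[/eqP e|] := bR' v vR' av; first by rewrite e (negPf ax) in av.
have [ay|ay] := boolP (attached R' y); last first.
  apply: W1 => //; last by rewrite size_cat f5.
  by move=> v vR' av; have /orP[|/eqP e] := bR' v vR' av; last by rewrite e (negPf ay) in av.
have xy : sedge x y.
  by apply: hy; apply: attachedW ax; apply: subset_trans (component_sub x'D) DR.
have [P [L [[hP P0 PL L1 PR] geo]]] := shortest_through cR' xR' yR' ax ay.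
have encR' : enclosed R' (x :: [::] ++ y :: [::]).
  split=> //=.
  - by rewrite xy sedge_sym xy.
  - by rewrite inE andbT; apply: contraTneq xy => ->; rewrite sedge_irr.
  - by move=> v; rewrite in_cons mem_seq1 => /orP[] /eqP->.
  - by move=> v vR' av; rewrite !inE; apply: bR'.
case: f f5 xs perm_y => [|z1 [|z2 f]] // [f3] _ _.
apply: (robber_loses_perm (c := [:: x; y; z1; z2] ++ f)).
  by rewrite /= perm_cons -cat1s perm_catC.
apply: (take_path (X := fun v => (v == x) || (v == y)) (I := fun s _ => s = [:: x; y; z1; z2])
  (R := R') (P := P) (L := L)) => //.
  move=> _ r0 -> r0R; split; last by move=> x0 _ _; exists [:: x; y; z1; z2] => //; apply: all2_stepxx.
  by move=> v /orP[]/eqP-> _; rewrite !inE eqxx ?orbT.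
move=> _ p r0 -> tr pL r0R' r0P.
have r0D : r0 \in off_chord R' P L.
  apply/setDP; split=> //; rewrite inE; apply/mem_arc => -[k hk e].
  by have := r0P k; rewrite e eqxx => /(_ _)/negP; apply; clear -hk L1; lia.
have := chord_split no_theta encR' hP P0 PL L1 PR geo r0D.
rewrite /= cats0 => encR0.
have [_ WX0] := IH _ (leq_trans (chord_component_card L1 PR r0D) (ltnW small)).
(* The other arc is empty and z1, z2 are its nominal guards. The ends x and y belong to P, so their
   cops become the idle ones. *)
apply: (robber_loses_perm (c := [:: z1; z2] ++ trio P L p ++ [:: x; y])).
  by permute.
have sub := chord_component_sub r0D.
apply: (WX0 P L [::] (fun s _ => size s = 2)) => //.
- by rewrite cats0.
- exact: geodesicW sub _ geo.
- move=> s' r1 s'2 _; split=> // x1 _ _; exists s' => //; exact: all2_stepxx.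
- exact: tracksW sub _ tr.
exact: component_refl.
Qed.

End Strategy.

(** * A territory between two tight paths *)

Section TwoTightArcs.
Variable G : sgraph.
Hypotheses (connG : connected_graph G) (no_theta : theta_free G).
Implicit Types (R : {set G}) (P : nat -> G) (r x y : G) (s f : seq G).

(** A chord between the outermost attached vertices of an arc leaves attached vertices of that arc
    on one side only, so each side is guarded by a single pair of cops. *)
Lemma extremes (a : pred G) (A : seq G) :
  [\/ exists a1 x C y a2, [/\ A = a1 ++ x :: C ++ y :: a2, a x, a y, ~~ has a a1 & ~~ has a a2],
      exists a1 x a2, [/\ A = a1 ++ x :: a2, a x, ~~ has a a1 & ~~ has a a2] |
      ~~ has a A].
Proof.
elim: A => [|v A IH]; first exact: Or33.
have [av|av] := boolP (a v); case: IH => [[a1 [x [C [y [a2 [-> ax ay h1 h2]]]]]]|[a1 [x [a2 [-> ax h1 h2]]]]|h].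
- by apply: Or31; exists [::], v, (a1 ++ x :: C), y, a2; rewrite -catA.
- by apply: Or31; exists [::], v, a1, x, a2.
- by apply: Or32; exists [::], v, A.
- by apply: Or31; exists (v :: a1), x, C, y, a2; rewrite /= (negPf av).
- by apply: Or32; exists (v :: a1), x, a2; rewrite /= (negPf av).
- by apply: Or33; rewrite /= (negPf av).
Qed.

Definition both_guards (I1 I2 : seq G -> G -> Prop) : seq G -> G -> Prop :=
  fun s r => exists s1 s2, [/\ s = s1 ++ s2, I1 s1 r, I2 s2 r & size s1 = 2 /\ size s2 = 2].

Lemma both_guards_guard R (X1 X2 : pred G) I1 I2 : guard R X1 I1 -> guard R X2 I2 ->
  guard R (fun v => X1 v || X2 v) (both_guards I1 I2).
Proof.
move=> g1 g2 s r [s1 [s2 [-> h1 h2 [z1 z2]]]] rR.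
have [b1 m1] := g1 s1 r h1 rR; have [b2 m2] := g2 s2 r h2 rR; split.
  by move=> y /orP[/b1 h /h|/b2 h /h]; rewrite mem_cat => ->; rewrite ?orbT.
move=> x xR rx; have [t1 st1 J1] := m1 x xR rx; have [t2 st2 J2] := m2 x xR rx.
exists (t1 ++ t2); first exact: all2_cat.
by exists t1, t2; rewrite -(all2_step_size st1) -(all2_step_size st2).
Qed.

Section Split.
Variable R : {set G}.
Hypothesis IH : forall R' : {set G}, #|R'| < #|R| -> wins_loose R'.
Variables (X1 X2 : pred G) (I1 I2 : seq G -> G -> Prop).
Hypotheses (g1 : guard R X1 I1) (g2 : guard R X2 I2).

(** The three idle cops take a path from x to y; the pair guarding the side that no longer matters
    becomes idle. *)
Lemma wins_split x y C1 C2 s1 s2 f r : enclosed R (x :: C1 ++ y :: C2) ->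
  attached R x -> attached R y ->
  (forall v, attached R v -> v \in x :: C1 ++ y :: C2 -> X1 v || X2 v) ->
  (forall v, attached R v -> v \in C1 -> X1 v) ->
  (forall v, attached R v -> v \in C2 -> X2 v) ->
  I1 s1 r -> I2 s2 r -> size s1 = 2 -> size s2 = 2 -> r \in R -> size f = 3 ->
  robber_loses (s1 ++ s2 ++ f) r.
Proof.
move=> encR ax ay cover c1 c2 h1 h2 z1 z2 rR f3; rewrite catA.
have xR : x \notin R by apply: (enclosed_disjoint encR); rewrite mem_head.
have yR : y \notin R by apply: (enclosed_disjoint encR); rewrite in_cons mem_cat mem_head !orbT.
have [P [L [[hP P0 PL L1 PR] geo]]] := shortest_through (enclosed_connected encR) xR yR ax ay.
have bX : bounded_by R (fun v => X1 v || X2 v).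
  by move=> v vR av; apply: cover => //; apply: (enclosed_bounded encR).
apply: (take_path connG (both_guards_guard g1 g2) bX hP geo) => //; last by exists s1, s2.
move=> _ p r0 [t1 [t2 [-> {}h1 {}h2 [{}z1 {}z2]]]] tr pL r0R r0P.
have r0D : r0 \in off_chord R P L.
  apply/setDP; split=> //; rewrite inE; apply/mem_arc => -[k hk e].
  by have := r0P k; rewrite e eqxx => /(_ _)/negP; apply; clear -hk L1; lia.
have := chord_split no_theta encR hP P0 PL L1 PR geo r0D.
have WX := IH (chord_component_card L1 PR r0D).
have sub := chord_component_sub r0D.
case: ifP => _.
  case=> _ enc1; apply: (robber_loses_perm (c := t1 ++ trio P L p ++ t2)); first by permute.
  apply: (WX P L (rev C1) I1) => //.
  - exact: geodesicW sub _ geo.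
  - by apply: (guardW sub _ g1) => v; rewrite mem_rev => vC av; apply: c1 => //; exact: attachedW sub av.
  - exact: tracksW sub _ tr.
  - exact: component_refl.
move=> enc2; apply: (robber_loses_perm (c := t2 ++ trio P L p ++ t1)); first by permute.
apply: (WX P L C2 I2) => //.
- exact: geodesicW sub _ geo.
- by apply: (guardW sub _ g2) => v vC av; apply: c2 => //; exact: attachedW sub av.
- exact: tracksW sub _ tr.
- exact: component_refl.
Qed.

Hypothesis W1 : wins_vertex R.

(** One idle cop walks to x while the guards hold; then the other six are free. *)
Lemma wins_single x s1 s2 f r : connected_in R -> bounded_by R (pred1 x) -> x \notin R ->
  bounded_by R (fun v => X1 v || X2 v) ->
  I1 s1 r -> I2 s2 r -> size s1 = 2 -> size s2 = 2 -> r \in R -> size f = 3 ->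
  robber_loses (s1 ++ s2 ++ f) r.
Proof.
move=> cR bx xR bX h1 h2 z1 z2 rR.
case: f => [//|z f] [f2].
apply: (robber_loses_perm (c := ((s1 ++ s2) ++ f) ++ [:: z])); first by permute.
apply: (@catch _ connG (fun s t r => [/\ exists2 s0, s = s0 ++ f & both_guards I1 I2 s0 r, t = 0 & r \in R])
  (fun=> [:: x]) 0 1 _ _ _ _ _ 0 r [:: z]) => //.
- by move=> _; apply: all2_stepxx.
- move=> _ t r' [[s0 -> b] -> r'R]; split=> // x' rx'; rewrite mem_cat negb_or => /andP[xs _].
  have x'R := guard_stays (both_guards_guard g1 g2) bX b r'R rx' xs.
  have [_ /(_ x' x'R rx')[s' st b']] := both_guards_guard g1 g2 b r'R.
  exists (s' ++ f); first exact: all2_cat (all2_stepxx _).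
  by right; exists 0 => //; split=> //; exists s'.
- move=> _ t r' [[s0 -> [t1 [t2 [-> _ _ [{}z1 {}z2]]]]] _ r'R].
  apply: (robber_loses_perm (c := x :: ((t1 ++ t2) ++ f))).
    by rewrite perm_sym cats1 perm_rcons.
  by apply: W1 => //; rewrite !size_cat z1 z2 f2.
- by split=> //; exists (s1 ++ s2) => //; exists s1, s2.
Qed.

End Split.

Lemma wins_tight_step R : (forall R' : {set G}, #|R'| < #|R| -> wins_loose R') -> wins_vertex R -> wins_tight R.
Proof.
move=> IH W1 A S IA IS sA sS f r An encR gA gS hA hS zA zS rR f3.
have [_ _ dis bR cR] := encR.
have bX : bounded_by R (fun v => (v \in A) || (v \in S)).
  by move=> v vR av; rewrite -mem_cat; apply: bR.
have none s v : ~~ has (attached R) s -> attached R v -> v \in s -> false.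
  by move=> /hasPn h av /h; rewrite av.
have two B T IB IT sB sT : enclosed R (B ++ T) -> guard R (fun v => v \in B) IB ->
    guard R (fun v => v \in T) IT -> IB sB r -> IT sT r -> size sB = 2 -> size sT = 2 ->
    (exists a1 x C y a2, [/\ B = a1 ++ x :: C ++ y :: a2, attached R x, attached R y,
       ~~ has (attached R) a1 & ~~ has (attached R) a2]) -> robber_loses (sB ++ sT ++ f) r.
  move=> encB gB gT hB hT zB zT [a1 [x [C [y [a2 [eB ax ay n1 n2]]]]]].
  have enclosed' : enclosed R (x :: C ++ y :: (a2 ++ T ++ a1)).
    have := encB; rewrite eB -catA => /enclosed_catC.
    by rewrite /= -!catA /= -?catA.
  apply: (wins_split IH gB gT enclosed') => //.
  - move=> v _; rewrite eB !(in_cons, mem_cat).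
    by case/or4P => [->|->|->|/or3P[]->]; rewrite ?orbT.
  - by move=> v _ vC; rewrite eB !(in_cons, mem_cat) vC !orbT.
  - move=> v av; rewrite !mem_cat => /or3P[h|//|h].
      by have := none _ _ n2 av h.
    by have := none _ _ n1 av h.
have encR' := enclosed_catC encR.
have swap : robber_loses (sS ++ sA ++ f) r -> robber_loses (sA ++ sS ++ f) r.
  by apply: robber_loses_perm; permute.
case: (extremes (attached R) A) => [hA2|hA1|hA0]; first exact: (two A S IA IS).
all: case: (extremes (attached R) S) => [hS2|hS1|hS0]; try by apply: swap; apply: (two S A IS IA).
- case: hA1 => a1 [x [a2 [eA ax n1 n2]]]; case: hS1 => b1 [y [b2 [eS ay m1 m2]]].
  have enclosed' : enclosed R (x :: (a2 ++ b1) ++ y :: (b2 ++ a1)).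
    have : enclosed R (a1 ++ (x :: a2 ++ b1 ++ y :: b2)) by move: encR; rewrite eA eS -!catA.
    move=> /enclosed_catC.
    by rewrite /= -!catA /= -?catA.
  apply: (wins_split IH gA gS enclosed') => //.
  + move=> v av; rewrite eA eS !(in_cons, mem_cat).
    by case/or4P => [->|/orP[]->|->|/orP[]->]; rewrite ?orbT.
  + move=> v av; rewrite mem_cat => /orP[h|h]; first by have := none _ _ n2 av h.
    by have := none _ _ m1 av h.
  + move=> v av; rewrite mem_cat => /orP[h|h]; first by have := none _ _ m2 av h.
    by have := none _ _ n1 av h.
- case: hA1 => a1 [x [a2 [eA ax n1 n2]]].
  apply: (wins_single gA gS W1 (x := x)) => //.
    move=> v vR av; have := bX v vR av; rewrite eA mem_cat in_cons => /orP[/or3P[h|//|h]|h].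
    + by have := none _ _ n1 av h.
    + by have := none _ _ n2 av h.
    + by have := none _ _ hS0 av h.
  by apply: dis; rewrite eA !(in_cons, mem_cat) eqxx !orbT.
- case: hS1 => a1 [x [a2 [eS ax n1 n2]]].
  apply: (wins_single gA gS W1 (x := x)) => //.
    move=> v vR av; have := bX v vR av; rewrite eS mem_cat in_cons => /orP[h|/or3P[h|//|h]].
    + by have := none _ _ hA0 av h.
    + by have := none _ _ n1 av h.
    + by have := none _ _ n2 av h.
  by apply: dis; rewrite eS !(in_cons, mem_cat) eqxx !orbT.
(* No vertex of the cycle is attached to R, so any vertex of A can play the enclosing vertex. *)
case: A An encR gA hA0 dis bX hA bR {two swap} encR' => [//|x A] _ encR gA hA0 dis bX hA _ _.
apply: (wins_single gA gS W1 (x := x)) => //; last by apply: dis; rewrite mem_head.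
move=> v vR av; have /orP[h|h] := bX v vR av; first by have := none _ _ hA0 av h.
by have := none _ _ hS0 av h.
Qed.

End TwoTightArcs.

(** * Replacing a path along a shortest detour *)

Section Detour.
Variable G : sgraph.
Hypotheses (connG : connected_graph G) (no_theta : theta_free G).
Variable R : {set G}.
Hypothesis IH : forall R' : {set G}, #|R'| < #|R| -> wins_loose R'.
Variables (P W : nat -> G) (L b t : nat) (S : seq G) (I : seq G -> G -> Prop).
Hypotheses (routeP : route P L) (encR : enclosed R (arc P 0 L.+1 ++ S))
  (geoP : geodesic 0 (fun i => i <= L) P R) (gI : guard R (fun v => v \in S) I).
Hypotheses (bt : b.+1 < t) (tL : t <= L) (routeW : route W L)
  (Wout : forall i, ~~ (b < i < t) -> W i = P i) (Win : forall i, b < i < t -> W i \in R)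
  (tight : geodesic 1 (fun i => b < i < t) P R).
Implicit Types (r x : G) (s f : seq G).

Lemma P_notin i : i <= L -> P i \notin R.
Proof.
move=> iL; apply: (enclosed_disjoint encR); rewrite mem_cat; apply/orP; left.
by apply/mem_arc; exists i => //; lia.
Qed.

Lemma W_ends i : b <= i <= t -> walk R (i - b) (W i) (P b) /\ walk R (t - i) (W i) (P t).
Proof.
move=> hi; rewrite -(@Wout b) -1?(@Wout t); try lia.
split; [apply: walk_sym|]; apply: walk_piece => [|k hk|k hk]; try lia; try (apply: Win; lia);
  apply: routeW; lia.
Qed.

(** A walk to W i extends along W to both ends of the window, which lie on P. So each bound that W
    puts on p follows from one that P puts on p. *)
Lemma W_witness r i n : i <= L -> walk R n r (W i) ->
  (exists j m, [/\ j <= L, walk R m r (P j) & j + n = i + m]) /\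
  (exists j m, [/\ j <= L, walk R m r (P j) & j + m = i + n]).
Proof.
move=> iL h; have [hi|hi] := boolP (b < i < t); last first.
  by split; exists i, n; rewrite -(Wout hi).
have [wb wt] : walk R (i - b) (W i) (P b) /\ walk R (t - i) (W i) (P t) by apply: W_ends; lia.
split; [exists t, (n + (t - i))|exists b, (n + (i - b))]; split; try lia;
  exact: walk_cat (Win hi) h _.
Qed.

Lemma geodesic_detour : geodesic 0 (fun i => i <= L) W R.
Proof.
move=> r i j n m rR iL jL /(W_witness iL)[[i' [n' [i'L hi ei]]] _].
move=> /(W_witness jL)[_ [j' [m' [j'L hj ej]]]].
by have := geoP rR i'L j'L hi hj; lia.
Qed.

Lemma tracks_detour p r : tracks 0 (fun i => i <= L) P R p r -> tracks 0 (fun i => i <= L) W R p r.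
Proof.
move=> tr i n iL /(W_witness iL)[[j [m [jL hj ej]]] [j' [m' [j'L hj' ej']]]].
by have := tr j m jL hj; have := tr j' m' j'L hj'; lia.
Qed.

Definition detour (k : nat) : G := W (b + k).
Definition inside : seq G := arc P b.+1 (t - b).-1.
Definition outside : seq G := arc P t.+1 (L - t) ++ S ++ arc P 0 b.
Definition open_land : {set G} := off_chord R detour (t - b).
(** Combinatorial form of lying between P and W inside the window. *)
Definition pocket r : bool := has (attached (component open_land r)) inside.

Lemma arcE : arc P 0 L.+1 = arc P 0 b ++ P b :: inside ++ P t :: arc P t.+1 (L - t).
Proof.
have -> : L.+1 = b + (1 + ((t - b).-1 + (1 + (L - t)))) by lia.
rewrite !arc_cat !add0n !addn1 /inside /=.
by have -> : b.+1 + (t - b).-1 = t by lia.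
Qed.

Lemma enclosed_detour : enclosed R (P b :: inside ++ P t :: outside).
Proof.
have : enclosed R (arc P 0 b ++ (P b :: inside ++ P t :: arc P t.+1 (L - t) ++ S)).
  by move: encR; rewrite arcE -!catA /= -!catA.
by move=> /enclosed_catC; rewrite /outside /= -!catA /= -!catA.
Qed.

Lemma detour_route : route detour (t - b).
Proof. by move=> i ib; rewrite /detour addnS; apply: routeW; lia. Qed.

Lemma detour0 : detour 0 = P b.
Proof. by rewrite /detour addn0 Wout //; lia. Qed.

Lemma detour_end : detour (t - b) = P t.
Proof. by rewrite /detour subnKC ?Wout //; lia. Qed.

Lemma detour_long : 1 < t - b.
Proof. by lia. Qed.

Lemma detour_inner i : 0 < i < t - b -> detour i \in R.
Proof. by move=> hi; apply: Win; lia. Qed.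

Lemma detour_geodesic : geodesic 0 (fun i => i <= t - b) detour R.
Proof.
move=> r i j n m rR ib jb hi hj.
by have := geodesic_detour rR (_ : b + i <= L) (_ : b + j <= L) hi hj; lia.
Qed.

Lemma open_landP r : reflect (r \in R /\ forall i, b < i < t -> r != W i) (r \in open_land).
Proof.
apply: (iffP setDP); rewrite inE => -[rR h]; split=> //.
  move=> i hi; apply: contraNneq h => ->; apply/mem_arc; exists (i - b); first by lia.
  by rewrite /detour subnKC //; lia.
apply/mem_arc => -[k hk e]; have := h (b + k); rewrite e eqxx => /(_ _)/negP; apply; lia.
Qed.

Lemma detour_split r : r \in open_land ->
  if pocket r
  then ~~ has (attached (component open_land r)) outside /\
    enclosed (component open_land r) (arc detour 0 (t - b).+1 ++ rev inside)
  else enclosed (component open_land r) (arc detour 0 (t - b).+1 ++ outside).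
Proof.
exact: (chord_split no_theta enclosed_detour detour_route detour0 detour_end
  detour_long detour_inner detour_geodesic).
Qed.

Lemma open_land_tracks p r : r \in R -> tracks 0 (fun i => i <= L) P R p r -> ~~ (b < p < t) ->
  r \in open_land.
Proof.
move=> rR /tracks_detour tr hp; apply/open_landP; split=> // i hi; apply/eqP => e.
have iL : i <= L by lia.
by have := tr i 0 iL; rewrite -e => /(_ (walk0 R r)); lia.
Qed.

(** From the pocket, P beyond the window is reached only across W, which is geodesic. Hence every
    interval [i - n, i + n] meets the open window. *)
Lemma pocket_walk r i n : r \in open_land -> pocket r -> i <= L -> walk R n r (P i) ->
  b < i + n /\ i < t + n.
Proof.
move=> rD pr iL hw; have := detour_split rD.
rewrite pr => -[/hasPn no _].
have n0 : 0 < n.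
  case: n hw => // /walk0E e; have := P_notin iL; rewrite -e.
  by have /open_landP[->] := rD.
have [hi|hi] : b <= i <= t \/ ~~ (b <= i <= t) by case: (b <= i <= t); [left|right].
  by lia.
have [f [f0 fn ff fR]] := hw.
have [[k [kn kD]]|stay] := pselect (exists k, k < n /\ f k \notin open_land).
  have k0 : 0 < k by case: k kn kD => // _; rewrite f0 rD.
  have fkR : f k \in R by apply: fR; lia.
  have [e [he fe]] : exists e, b < e < t /\ f k = W e.
    have [//|no'] := pselect (exists e, b < e < t /\ f k = W e).
    case/negP: kD; apply/open_landP; split=> // e he; apply/eqP => ee.
    by apply: no'; exists e.
  have hk : walk R (n - k) (f k) (W i).
    rewrite Wout; last by lia.
    by rewrite -fn; apply: walk_piece => [|l hl|l hl]; [lia|apply: ff; lia|apply: fR; lia].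
  have h0 : walk R 0 (f k) (W e) by rewrite -fe; apply: walk0.
  have h1 := geodesic_detour fkR (_ : e <= L) iL h0 hk.
  by have := geodesic_detour fkR iL (_ : e <= L) hk h0; lia.
have inC k : k < n -> f k \in component open_land r.
  elim: k => [|k IHk] kn; first by rewrite f0 component_refl.
  apply: (component_closed rD (IHk (ltnW kn))); first by apply: ff; lia.
  by apply/negPn/negP => c; apply: stay; exists k.+1.
have iout : P i \in outside.
  rewrite /outside !mem_cat; have [h|h] : i < b \/ t < i by lia.
    by apply/or3P/Or33/mem_arc; exists i => //; lia.
  by apply/or3P/Or31/mem_arc; exists i => //; lia.
have lt : n.-1 < n by lia.
have := no _ iout; rewrite (attachedI (inC n.-1 lt)) // -fn sedge_sym.
by rewrite -{2}(prednK n0); apply: ff.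
Qed.

(** By [pocket_walk] the window joins the intervals in Helly's argument: against a robber in the
    pocket, p can be kept inside or moved towards it. *)
Lemma respond s r p x : I s r -> tracks 0 (fun i => i <= L) P R p r -> p <= L -> r \in R ->
  x \in R -> step r x ->
  exists s' p', [/\ all2 (@step G) s s', I s' x, tracks 0 (fun i => i <= L) P R p' x, p' <= L &
    [/\ p' <= p.+1, p <= p'.+1 & x \in open_land -> pocket x ->
      [/\ b < p < t -> b < p' < t, p <= b -> p' = p.+1 & t <= p -> p = p'.+1]]].
Proof.
move=> Is tr pL rR xR rx.
have [_ /(_ x xR rx)[s' st Is']] := gI Is rR.
have [p1 [tr1 p1L h1 h2]] := tracks_step (leq0n 1) geoP (fun i iL => iL) tr pL xR rx.
have [/andP[xD px]|np] := boolP ((x \in open_land) && pocket x); last first.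
  by exists s', p1; split=> //; split=> // xD px; rewrite xD px in np.
have near i n : i <= L -> walk R n x (P i) -> i <= p + n.+1 /\ p <= i + n.+1.
  by move=> iL /(walk_step xR rx)[m mn hm]; have := tr i m iL hm; lia.
have bound i n := @pocket_walk x i n xD px.
have [p' [hp' e1 e2 e3]] : exists p', [/\ p' = p1 \/ (p' = p /\ (p1 = b \/ p1 = t)) \/
   (p <= b /\ p' = p.+1) \/ (t <= p /\ p = p'.+1),
   b < p < t -> b < p' < t, p <= b -> p' = p.+1 & t <= p -> p = p'.+1].
  have [h|[h|h]] : p <= b \/ t <= p \/ b < p < t by lia.
  - by exists p.+1; split; lia.
  - by exists p.-1; split; lia.
  - have [c|c] : b < p1 < t \/ (p1 = b \/ p1 = t) by lia.
      by exists p1; split; lia.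
    by exists p; split; lia.
exists s', p'; split=> //; [|lia|split=> //; lia].
move=> i n iL hi; have := bound i n iL hi; have := near i n iL hi; have := tr1 i n iL hi; lia.
Qed.

(** Outside the pocket the window part of P no longer borders the robber's component, so W takes the
    place of P. *)
Lemma exit_detour s p f x : x \in open_land -> ~~ pocket x -> I s x -> size s = 2 ->
  tracks 0 (fun i => i <= L) P R p x -> p <= L -> size f = 2 -> robber_loses (s ++ trio W L p ++ f) x.
Proof.
move=> xD nx Is s2 /tracks_detour tr pL f2.
have := detour_split xD; rewrite (negPf nx) => enclosed'.
have sub : component open_land x \subset R := chord_component_sub xD.
apply: (IH (chord_component_card detour_long detour_inner xD) (S := S) (I := I)) => //.
- have : enclosed (component open_land x) (arc W b (t - b).+1 ++ outside).
    suff -> : arc W b (t - b).+1 = arc detour 0 (t - b).+1 by [].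
    by rewrite /arc -[X in iota X]addn0 iotaDl -map_comp.
  rewrite /outside !catA => /enclosed_catC; rewrite !catA.
  have -> : L.+1 = b + ((t - b).+1 + (L - t)) by lia.
  rewrite !arc_cat add0n addnS subnKC; last by lia.
  have -> : arc P 0 b = arc W 0 b by apply: eq_arc => k hk; rewrite Wout //; lia.
  suff -> : arc P t.+1 (L - t) = arc W t.+1 (L - t) by rewrite !catA.
  by apply: eq_arc => k hk; rewrite Wout //; lia.
- exact: geodesicW sub _ geodesic_detour.
- by apply: (guardW sub _ gI) => v.
- exact: tracksW sub _ tr.
- exact: component_refl.
Qed.

Lemma boundary_cases x : x \notin R -> attached R x -> (exists2 i, i <= L & x = P i) \/ x \in S.
Proof.
move=> xR ax; have := enclosed_bounded encR xR ax; rewrite mem_cat => /orP[/mem_arc[i hi e]|]; last by right.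
by left; exists i; [lia|].
Qed.

Lemma stays_inside s r x (c : seq G) : I s r -> r \in R -> step r x -> {subset s <= c} -> x \notin c ->
  (forall i, i <= L -> sedge r (P i) -> P i \in c) -> x \in R.
Proof.
move=> Is rR /orP[/eqP<-//|rx] sc xc hc; apply/negPn/negP => xR.
have xr : sedge x r by rewrite sedge_sym.
have [[i iL e]|xS] := boundary_cases xR (attachedI rR xr).
- by case/negP: xc; rewrite e; apply: hc; rewrite -?e.
- have [h _] := gI Is rR; case/negP: xc; apply: sc; exact: h.
Qed.

Lemma stop_out i : ~~ (b < i < t) -> i <= L -> stop W L i = stop P L i.
Proof. by move=> hi iL; rewrite /stop (minn_idPl iL) Wout. Qed.

Definition wings p : seq G := [:: stop W L p.-1; stop W L p.+1].

Lemma wings_step p p' : p <= p'.+1 -> p' <= p.+1 -> all2 (@step G) (wings p) (wings p').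
Proof. by move=> h1 h2; rewrite /= !step_stop //; lia. Qed.

(* The two cops duo P q contain the cop P p, so together with the wings they  *)
(* guard W as soon as p leaves the window.                                    *)
Definition window_state (c : seq G) (p : nat) r : Prop := exists s q,
  [/\ c = s ++ duo P L q ++ wings p, I s r, size s = 2, r \in R &
  [/\ b < p < t, q = p \/ p = q.+1, tracks 0 (fun i => i <= L) P R p r &
     tracks 1 (fun i => b < i < t) P R q r]].

Lemma tracks_inside p r : tracks 0 (fun i => i <= L) P R p r -> tracks 0 (fun i => b < i < t) P R p r.
Proof. by apply: tracksW => // i; lia. Qed.

(** The index leaves the window only when the robber is outside the pocket. Then P and W agree at
    p', and the cop on P p steps there to complete the three on W. *)
Lemma window_step c p r x : window_state c p r -> step r x -> x \notin c -> x \in R /\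
  ((exists c' p', [/\ all2 (@step G) c c', window_state c' p' x, p <= p'.+1 & p' <= p.+1]) \/
   (exists2 c', all2 (@step G) c c' & forall f, size f = 1 -> robber_loses (c' ++ f) x)).
Proof.
case=> s [q [-> Is s2 rR [hp hq tr tr1]]] rx xc.
have xR : x \in R.
  apply: (stays_inside Is rR rx _ xc) => [v vs|i iL ri]; first by rewrite mem_cat vs.
  have := tracks_adjacent tr iL ri; rewrite addn0 => -[h1 h2].
  rewrite !mem_cat; apply/or3P; have [hi|hi] := boolP (b < i < t).
    have := tracks_adjacent tr1 hi ri; rewrite addn1 => -[h3 h4].
    by apply: Or32; apply: duo_blocks => //; lia.
  apply: Or33; have iE : W i = stop W L i by rewrite /stop (minn_idPl iL).
  rewrite -Wout // iE !inE; have [->|->] : i = p.-1 \/ i = p.+1 by lia.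
    by rewrite eqxx.
  by rewrite eqxx orbT.
split=> //; have pL : p <= L by lia.
have [s' [p' [st Is' tr' p'L [h1 h2 hpocket]]]] := respond Is tr pL rR xR rx.
have [hp'|hp'] := boolP (b < p' < t); [left|right].
  have near i n : b < i < t -> walk R n x (P i) ->
      [/\ i <= q + n.+1, q.+1 <= i + n.+1, i <= p' + n & p' <= i + n].
    move=> hi hw; have [m mn hm] := walk_step xR rx hw.
    by have := tr1 i m hi hm; have := tracks_inside tr' hi hw; split; lia.
  (* If the index from [tracks_tighten] is two away from q, the index between them also works: its
     missing bounds are inherited from q. *)
  have [q' [hq' hqq trq']] : exists q', [/\ q' = p' \/ p' = q'.+1, q' <= q.+1 /\ q <= q'.+1 &
      tracks 1 (fun i => b < i < t) P R q' x].
    case: (tracks_tighten tight xR (tracks_inside tr')) => [h|[q' e h]].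
      have [small|large] : p' <= q.+1 \/ p' = q.+2 by lia.
        by exists p'; split=> //; lia.
      by exists p; split=> [||i n hi hw]; [lia|lia|have [? ? ? ?] := near i n hi hw; lia].
    have [small|large] : q <= q'.+1 \/ q = q'.+2 by lia.
      by exists q'; split=> //; lia.
    by exists p'; split=> [||i n hi hw]; [lia|lia|have [? ? ? ?] := near i n hi hw; lia].
  exists (s' ++ duo P L q' ++ wings p'), p'; split=> //.
    by rewrite !all2_cat ?wings_step // duo_step //; case: hqq.
  by exists s', q'; split=> //; rewrite -(all2_step_size st).
have xD := open_land_tracks xR tr' hp'.
have nx : ~~ pocket x by apply/negP => px; have [h _ _] := hpocket xD px; rewrite h in hp'.
have step_p : step (stop P L p) (stop W L p').
  by rewrite stop_out //; apply: step_stop => //; lia.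
have s'2 : size s' = 2 by rewrite -(all2_step_size st).
case: hq => e.
  exists (s' ++ [:: stop W L p'; stop P L q.+1] ++ wings p').
    by rewrite !all2_cat ?wings_step //= e step_p stepxx.
  move=> f f1; apply: (robber_loses_perm (c := s' ++ trio W L p' ++ stop P L q.+1 :: f)).
    by permute.
  by apply: exit_detour => //=; rewrite f1.
exists (s' ++ [:: stop P L q; stop W L p'] ++ wings p').
  by rewrite !all2_cat ?wings_step //= -e step_p stepxx.
move=> f f1; apply: (robber_loses_perm (c := s' ++ trio W L p' ++ stop P L q :: f)).
  by permute.
by apply: exit_detour => //=; rewrite f1.
Qed.

(** With the seventh cop on W p the detour is closed. In the pocket the robber is enclosed by the
    two cops on P and the three on W, and the guards of S are released; outside it, the two on P
    are. *)
Lemma window_closed c p r : window_state c p r -> robber_loses (c ++ [:: stop W L p]) r.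
Proof.
move=> win; apply: robber_losesI => x rx; rewrite mem_cat negb_or => /andP[xc xp].
have [xR [[c' [p' [st win' h1 h2]]]|[c' st lose]]] := window_step win rx xc; last first.
  by exists (c' ++ [:: stop W L p]); [apply: all2_cat (all2_stepxx _) | apply: lose].
exists (c' ++ [:: stop W L p']).
  by apply: all2_cat => //; rewrite /= step_stop.
have xD : x \in open_land.
  apply/open_landP; split=> // i hi; apply/eqP => e.
  case: win => s [q [ec _ _ _ [hp _ /tracks_detour tr _]]].
  have iL : i <= L by lia.
  rewrite e in rx; have [h3 h4] := tracks_meets tr iL rx.
  have : W i \in trio W L p by apply: trio_blocks.
  move: xc xp; rewrite ec e !mem_cat !inE !negb_or => /andP[_ /andP[_ /andP[/negPf-> /negPf->]]].
  by move=> /negPf->.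
case: win' => s [q [-> Is s2 _ [hp hq tr tr1]]].
have [px|nx] := boolP (pocket x); last first.
  apply: (robber_loses_perm (c := s ++ trio W L p' ++ duo P L q)); first by permute.
  by apply: exit_detour => //; lia.
have := detour_split xD; rewrite px => -[_ enclosed'].
have sub : component open_land x \subset R := chord_component_sub xD.
have trioE : trio detour (t - b) (p' - b) = trio W L p'.
  rewrite /trio /stop /detour; congr [:: W _; W _; W _]; lia.
apply: (robber_loses_perm (c := duo P L q ++ trio detour (t - b) (p' - b) ++ s)).
  by rewrite trioE; permute.
apply: (IH (chord_component_card detour_long detour_inner xD) (S := rev inside)
  (I := duo_guard (fun i => b < i < t) P L (component open_land x))) => //.
- exact: detour_route.
- exact: geodesicW sub _ detour_geodesic.
- have DL i : b < i < t -> i <= L by lia.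
  apply: (guardW (subxx _) _ (duo_guardP routeP DL (geodesicW sub (fun i hi => hi) tight))).
  move=> v; rewrite mem_rev => /mem_arc[k hk ->] _; apply/existsP.
  have kL : k < L.+1 by lia.
  by exists (Ordinal kL); rewrite /= eqxx andbT; lia.
- by exists q; split=> //; [exact: tracksW sub _ tr1 | lia].
- move=> i n ib hw; have := tracks_detour tr (_ : b + i <= L) (walkW sub hw); lia.
- by lia.
- exact: component_refl.
Qed.

(** Tightness inside the window frees one of the three cops on P, who walks to W p. *)
Lemma window_wins s p r : I s r -> size s = 2 -> r \in R -> b < p < t ->
  tracks 0 (fun i => i <= L) P R p r -> robber_loses (s ++ trio P L p ++ wings p) r.
Proof.
move=> Is s2 rR hp tr; have pL : p <= L by lia.
have start z q : q = p \/ p = q.+1 -> tracks 1 (fun i => b < i < t) P R q r ->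
    robber_loses ((s ++ duo P L q ++ wings p) ++ [:: z]) r.
  move=> hq tr1.
  apply: (@catch _ connG window_state (fun k => [:: stop W L k]) L 1 _ _ _ _ _ p r [:: z]) => //.
  - by move=> i; rewrite /= step_stop //; lia.
  - move=> c' p' r' win; split; first by case: win => ? [? [_ _ _ _ []]]; lia.
    move=> x rx xc; have [_ [[c'' [p'' [st win'' h _]]]|[c'' st lose]]] := window_step win rx xc.
      by exists c'' => //; right; exists p''.
    by exists c'' => //; left.
  - by move=> c' p' r'; apply: window_closed.
  - by exists s, q.
case: (tracks_tighten tight rR (tracks_inside tr)) => [h|[q e h]].
  apply: (robber_loses_perm _ (start (stop P L p.-1) p _ h)); last by left.
  by rewrite /trio; permute.
apply: (robber_loses_perm _ (start (stop P L p.+1) q _ h)); last by right.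
by rewrite /trio e; permute.
Qed.

(** While the robber is in the pocket, p approaches the window in every round. If he is outside the
    pocket with p outside the window, P p = W p and the wings complete the three cops on W. *)
Lemma wings_win s p r : I s r -> size s = 2 -> r \in R -> p <= L ->
  tracks 0 (fun i => i <= L) P R p r -> robber_loses (s ++ trio P L p ++ wings p) r.
Proof.
have base s' p' r' : I s' r' -> size s' = 2 -> r' \in R -> p' <= L ->
    tracks 0 (fun i => i <= L) P R p' r' -> b < p' < t \/ ~~ pocket r' ->
    robber_loses (s' ++ trio P L p' ++ wings p') r'.
  move=> Is s2 rR pL tr; have [hp _|hp [//|np]] := boolP (b < p' < t).
    exact: window_wins.
  apply: (robber_loses_perm (c := s' ++ trio W L p' ++ [:: stop P L p'.-1; stop P L p'.+1])).
    by rewrite /trio (stop_out hp pL); permute.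
  by apply: exit_detour => //; apply: open_land_tracks tr hp.
move: {2}(b.+1 - p + (p.+1 - t)) (leqnn (b.+1 - p + (p.+1 - t))) => d.
elim: d s p r => [|d IHd] s p r dp Is s2 rR pL tr.
  by apply: base => //; left; lia.
have [hp|hp] := boolP (b < p < t); first by apply: base => //; left.
have [pr|nr] := boolP (pocket r); last by apply: base => //; right.
apply: robber_losesI => x rx; rewrite catA mem_cat negb_or => /andP[xc _].
have xR : x \in R.
  apply: (stays_inside Is rR rx _ xc) => [v vs|i iL ri]; first by rewrite mem_cat vs.
  have [h1 h2] := tracks_adjacent tr iL ri; rewrite addn0 in h2.
  by rewrite mem_cat trio_blocks ?orbT.
have [s' [p' [st Is' tr' p'L [h1 h2 hpocket]]]] := respond Is tr pL rR xR rx.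
have s'2 : size s' = 2 by rewrite -(all2_step_size st).
exists (s' ++ trio P L p' ++ wings p').
  by rewrite -catA !all2_cat ?wings_step ?trio_step.
have [px|nx] := boolP (pocket x); last by apply: base => //; right.
have [hp'|hp'] := boolP (b < p' < t); first by apply: base => //; left.
have xD := open_land_tracks xR tr' hp'.
by apply: IHd => //; have [_ ? ?] := hpocket xD px; lia.
Qed.

Lemma detour_wins s p f r : I s r -> size s = 2 -> r \in R -> p <= L -> size f = 2 ->
  tracks 0 (fun i => i <= L) P R p r -> robber_loses (s ++ trio P L p ++ f) r.
Proof.
move=> Is s2 rR pL f2 tr; rewrite catA.
apply: (@catch _ connG (fun c p r => exists s, [/\ c = s ++ trio P L p, I s r, size s = 2, r \in R &
    p <= L /\ tracks 0 (fun i => i <= L) P R p r]) wings L 2 _ _ _ _ _ p r f) => //.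
- by move=> i; apply: wings_step; lia.
- move=> _ p' r' [s' [-> Is' s'2 r'R [p'L tr']]]; split=> // x rx xc.
  have xR : x \in R.
    apply: (stays_inside Is' r'R rx _ xc) => [v vs|i iL ri]; first by rewrite mem_cat vs.
    have [h1 h2] := tracks_adjacent tr' iL ri; rewrite addn0 in h2.
    by rewrite mem_cat trio_blocks ?orbT.
  have [s'' [p'' [st Is'' tr'' p''L [h1 h2 _]]]] := respond Is' tr' p'L r'R xR rx.
  exists (s'' ++ trio P L p''); first by rewrite all2_cat ?trio_step.
  by right; exists p'' => //; exists s''; split=> //; rewrite -(all2_step_size st).
- move=> _ p' r' [s' [-> Is' s'2 r'R [p'L tr']]]; rewrite -catA; exact: wings_win.
- by exists s.
Qed.

End Detour.

(** * Seven cops *)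

Section SevenCops.
Variable G : sgraph.
Hypotheses (connG : connected_graph G) (no_theta : theta_free G).
Implicit Types (R : {set G}).

(** Take a failure of tightness with the least index difference t - b. Its walk has exactly this
    length, so W keeps the indices of P, and minimality makes P tight strictly between b and t. *)
Lemma shortest_detour R (P : nat -> G) L : route P L -> geodesic 0 (fun i => i <= L) P R ->
  (forall i, i <= L -> P i \notin R) -> ~ geodesic 1 (fun i => i <= L) P R ->
  exists W b t, [/\ b.+1 < t, t <= L, route W L,
    forall i, ~~ (b < i < t) -> W i = P i & forall i, b < i < t -> W i \in R] /\
    geodesic 1 (fun i => b < i < t) P R.
Proof.
move=> hP geo PR loose.
pose wide d := exists r i j n m, [/\ r \in R, i <= L, walk R n r (P i), walk R m r (P j) &
  i = j + n + m /\ d = i - j].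
have ex : exists d, `[< wide d >].
  have [[d hd]|no] := pselect (exists d, wide d); first by exists d; apply/asboolP.
  case: loose => r i j n m rR iL jL hi hj; rewrite leqNgt; apply/negP => c.
  apply: no; exists (i - j), r, i, j, n, m; split=> //; split=> //.
  by have := geo r i j n m rR iL jL hi hj; lia.
case: (ex_minnP ex) => d /asboolP[r [t [b [n [m [rR tL ht hb [e ed]]]]]]] dmin.
have pos i k : i <= L -> walk R k r (P i) -> 0 < k.
  by case: k => // iL /walk0E ei; have := PR i iL; rewrite -ei rR.
have n0 := pos _ _ tL ht; have m0 : 0 < m by apply: pos hb; lia.
have [f [f0 fn ff fR]] := walk_cat rR (walk_sym hb) ht.
pose W i := if b < i < t then f (i - b) else P i.
have WE i : b <= i <= t -> W i = f (i - b).
  move=> hi; rewrite /W; case: ifP => // h; have [->|->] : i = b \/ i = t by lia.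
    by rewrite subnn f0.
  by rewrite (_ : t - b = m + n) ?fn //; lia.
exists W, b, t; split; first split=> //.
- by lia.
- move=> i iL; have [h|h] := boolP (b <= i < t).
    by rewrite !WE; try lia; rewrite subSn; [apply: ff; lia|lia].
  rewrite /W; case: ifP => h1; first by lia.
  by case: ifP => h2; [lia|apply: hP].
- by move=> i h; rewrite /W (negPf h).
- by move=> i h; rewrite WE; [apply: fR|]; lia.
move=> r' i j n' m' r'R hi hj wi wj; have iL : i <= L by lia.
have jL : j <= L by lia.
rewrite leqNgt; apply/negP => c; have := geo r' i j n' m' r'R iL jL wi wj.
have /dmin : `[< wide (i - j) >].
  apply/asboolP; exists r', i, j, n', m'; split=> //; split=> //.
  by have := geo r' i j n' m' r'R iL jL wi wj; lia.
by lia.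
Qed.

Lemma wins_loose_step R : (forall R' : {set G}, #|R'| < #|R| -> wins_loose R') -> wins_tight R -> wins_loose R.
Proof.
move=> IH WY P L S I p s f r hP encR geo gI Is s2 tr pL rR f2.
have PR i : i <= L -> P i \notin R.
  move=> iL; apply: (enclosed_disjoint encR); rewrite mem_cat; apply/orP; left.
  by apply/mem_arc; exists i.
have [tight|loose] := pselect (geodesic 1 (fun i => i <= L) P R); last first.
  have [W [b [t [[bt tL hW Wout Win] tight]]]] := shortest_detour hP geo PR loose.
  exact: (detour_wins connG no_theta IH hP encR geo gI bt tL hW Wout Win tight).
have DL i : i <= L -> i <= L by [].
have gP : guard R (fun v => v \in arc P 0 L.+1) (duo_guard (fun i => i <= L) P L R).
  apply: (guardW (subxx _) _ (duo_guardP hP DL tight)) => v /mem_arc[k hk ->] _.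
  have kL : k < L.+1 by [].
  by apply/existsP; exists (Ordinal kL); rewrite /= eqxx andbT.
have start q z : q <= L -> tracks 1 (fun i => i <= L) P R q r ->
    robber_loses (duo P L q ++ s ++ z :: f) r.
  move=> qL tr1; apply: (WY _ S _ I _ _ _ _ _ encR gP gI) => //=; last by rewrite f2.
  by exists q.
case: (tracks_tighten tight rR tr) => [h|[q e h]].
  apply: (robber_loses_perm _ (start p (stop P L p.-1) pL h)).
  by rewrite /trio; permute.
have qL : q <= L by lia.
apply: (robber_loses_perm _ (start q (stop P L p.+1) qL h)).
by rewrite /trio e; permute.
Qed.

Lemma wins_all R : wins_vertex R /\ wins_loose R.
Proof.
elim: {R}#|R| {-2}R (leqnn #|R|) => [|n IH] R Rn.
  split=> [x f r _ _ _|P L S I p s f r _ _ _ _ _ _ _ _] rR.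
    by move: Rn; rewrite leqn0 cards_eq0 => /eqP R0; rewrite R0 inE in rR.
  by move: Rn; rewrite leqn0 cards_eq0 => /eqP R0; rewrite R0 inE in rR.
have IH' (R' : {set G}) : #|R'| < #|R| -> wins_vertex R' /\ wins_loose R' by move=> h; apply: IH; lia.
have IHX (R' : {set G}) : #|R'| < #|R| -> wins_loose R' by move=> /IH'[].
have W1 := wins_vertex_step connG no_theta IH'.
by split=> //; exact: wins_loose_step IHX (wins_tight_step connG no_theta IHX W1).
Qed.

Lemma seven_cops_win (x0 : G) : cops_win G 7.
Proof.
set c := nseq 7 x0; suff : cops_win G (size c) by rewrite size_nseq.
apply: cops_win_of_robber_loses => r.
exists c; first exact: all2_stepxx.
(* All cops wait on x0 for one round, so that the robber's first move puts him off x0 and fixes his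
   territory. *)
apply: robber_losesI => x _ xc; have xx0 : x != x0 by move: xc; rewrite mem_nseq.
exists c; first exact: all2_stepxx.
have xD : x \in [set~ x0] by rewrite !inE.
have [W1 _] := wins_all (component [set~ x0] x).
apply: (W1 x0 (nseq 6 x0)) => //.
- by apply/negP => /(subsetP (component_sub xD)); rewrite !inE eqxx.
- exact: component_connected.
- have all_in : bounded_by [set: G] (pred1 x0) by move=> v; rewrite inE.
  move=> v vC av; have := component_bounded xD (subsetT _) all_in vC av.
  by rewrite !inE andbF negbK andbT.
- exact: component_refl.
Qed.

End SevenCops.

Theorem theorem2p7 (R : realType) (G : sgraph) :
  connected_graph G -> planar R G -> surrounding_cop_number G <= 7.
Proof.
move=> connG /planar_lattice_drawing[node [line drawn]].
rewrite /surrounding_cop_number; case: ex_minnP => m _ m_min.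
have [x0 _|G0] := pickP (fun _ : G => true).
  apply/m_min/asboolP/(seven_cops_win connG _ x0).
  exact: lattice_drawing_theta_free drawn.
have card0 : #|G| = 0 by apply: eq_card0 => x; have := G0 x.
by rewrite (leq_trans (m_min 0 _)) //; apply/asboolP; rewrite -card0; apply: cops_win_card.
Qed.
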